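(* Assume $\lambda>1/4$. Let $Q(\infty)=(Q_n(\infty))_{n\ge1}$ be the limit in distribution, as $t\to\infty$, of the infinite-tandem back-pressure process $Q(t)$ with arrival rate $\lambda$ started from the zero state. Then $Q_1(\infty)=\infty$ with probability $1$ (and then $Q_n(\infty)=\infty$ with probability $1$ for all $n\ge1$).
   Context: Infinite-tandem back-pressure process: sites are $n=1,2,\dots$; customers arrive at site $1$ by a Poisson process of rate $\lambda$; each site $n$ has a unit-rate Poisson process $\Pi_n$; all these processes are independent. $Q_n(t)$ is the number of customers at site $n$ at time $t$, $Q(t)=(Q_n(t))_{n\ge1}$. At each point $\tau$ of $\Pi_n$ one customer moves from site $n$ to site $n+1$ if $Q_n(\tau-)>Q_{n+1}(\tau-)$; otherwise nothing happens. Customers never leave. Each component takes values in $\overline{\mathbb{Z}}_+=\mathbb{Z}_+\cup\{\infty\}$, made compact with the metric $|e^{-i}-e^{-j}|$, with convention $\infty\pm1=\infty$; the state space $\overline{\mathbb{Z}}_+^{\{1,2,\dots\}}$ has the product topology, with respect to which convergence in distribution is understood. Started from the zero state (all queues $0$), $Q(t)$ is stochastically non-decreasing in $t$ and converges in distribution; the limit is denoted $Q(\infty)$. *)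

(* Defs.v *)
From HB Require Import structures.
From mathcomp Require Import all_boot all_order all_algebra.
From mathcomp Require Import all_classical all_reals all_analysis.

Set Implicit Arguments.
Unset Strict Implicit.
Unset Printing Implicit Defensive.

Import Order.TTheory GRing.Theory Num.Theory.
Import numFieldNormedType.Exports.
Local Open Scope classical_set_scope.
Local Open Scope ring_scope.

(* [None] stands for infinity.  Pulling the metric of R back along
   i |-> e^-i gives the metric |e^-i - e^-j|, with e^-oo = 0. *)
Definition exp_neg (R : realType) (x : option nat) : R :=
  if x is Some i then expR (- i%:R) else 0.

Definition enat (R : realType) : Type := initial_topology (@exp_neg R).

(* Sites are 1, 2, ...; coordinate n is the queue of site n + 1. *)
Definition state (R : realType) : Type := {ptws nat -> enat R}.

(* [omap succn] and [omap predn] below implement infinity +- 1 = infinity. *)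
Definition enat_lt (x y : option nat) : bool :=
  match x, y with
  | Some i, Some j => (i < j)%N
  | Some _, None => true
  | None, _ => false
  end.

Section path.
Variable R : realType.
Implicit Types (x : state R) (q : R -> state R).

Definition zero_state : state R := fun=> Some 0%N.

Definition arrival x : state R :=
  fun m => if m == 0%N then omap succn (x m) else x m.

Definition service (n : nat) x : state R :=
  if enat_lt (x n.+1) (x n) then
    fun m => if m == n then omap predn (x m)
             else if m == n.+1 then omap succn (x m) else x m
  else x.

(* The points of a point process with counting path N; N is used with
   nondecreasing right-continuous paths, so these are its jump times. *)
Definition point_of (N : R -> nat) (tau : R) : Prop :=
  0 < tau /\ forall s, 0 <= s < tau -> (N s < N tau)%N.

(* q is the right-continuous path with left limits started from the zero state
   and driven by the arrival points of a and the service points of s n. *)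
Definition bp_path (a : R -> nat) (s : nat -> R -> nat) q : Prop :=
  [/\ q 0 = zero_state,
      forall t, 0 <= t -> q u @[u --> t^'+] --> q t
    & forall tau, 0 < tau -> exists ql : state R,
      [/\ q u @[u --> tau^'-] --> ql,
          point_of a tau -> q tau = arrival ql,
          forall n, point_of (s n) tau -> q tau = service n ql
        & ~ point_of a tau -> (forall n, ~ point_of (s n) tau) -> q tau = ql]].

End path.

Section probability.
Context (R : realType) d (T : measurableType d) (P : probability T R).

Definition mutually_independent (I : eqType) (F : I -> set_system T) : Prop :=
  forall (s : seq I) (E : I -> set T), uniq s ->
    (forall i, i \in s -> F i (E i)) ->
    P (\big[setI/setT]_(i <- s) E i) = (\prod_(i <- s) P (E i))%E.

Definition sigma_process (N : R -> {RV P >-> nat}) : set_system T :=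
  <<s \bigcup_(t in [set t : R | 0 <= t])
        preimage_set_system setT (N t) measurable >>.

(* Counting process (N t)_{t >= 0} of a homogeneous Poisson process.  Paths are
   nondecreasing almost surely, so the truncated subtraction is harmless. *)
Record poisson_process (rate : R) (N : R -> {RV P >-> nat}) : Prop := {
  poisson_start : {ae P, forall w, N 0 w = 0%N} ;
  poisson_nondecreasing :
    {ae P, forall w, forall s t, 0 <= s -> s <= t -> (N s w <= N t w)%N} ;
  poisson_right_continuous :
    {ae P, forall w, forall t, 0 <= t -> N u w @[u --> t^'+] --> N t w} ;
  poisson_increment : forall s t k, 0 <= s -> s < t ->
    P [set w | N t w = (N s w + k)%N] = (poisson_pmf (rate * (t - s)) k)%:E ;
  poisson_independent_increments : forall t : nat -> R,
    0 <= t 0%N -> (forall i, t i <= t i.+1) ->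
    mutually_independent (fun i : nat =>
      preimage_set_system setT (fun w => (N (t i.+1) w - N (t i) w)%N)
        measurable) }.

(* Measurability for the Borel sigma-algebra of [state R], which is generated
   by the coordinates since each coordinate is countable with Borel points. *)
Definition random_state (X : T -> state R) : Prop :=
  forall (n : nat) (x : option nat), measurable [set w | X w n = x].

Record backpressure_process (lambda : R) (A : R -> {RV P >-> nat})
    (S : nat -> R -> {RV P >-> nat}) (Q : R -> T -> state R) : Prop := {
  bp_arrivals : poisson_process lambda A ;
  bp_services : forall n, poisson_process 1 (S n) ;
  bp_independent : mutually_independent (fun i : option nat =>
    sigma_process (if i is Some n then S n else A)) ;
  bp_measurable : forall t, 0 <= t -> random_state (Q t) ;
  bp_dynamics : {ae P, forall w,
    bp_path (A^~ w) (fun n t => S n t w) (Q^~ w)} }.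

End probability.

Definition cvg_in_distribution (R : realType)
    d (T : measurableType d) (P : probability T R) (X : R -> T -> state R)
    d' (T' : measurableType d') (P' : probability T' R) (Y : T' -> state R) :=
  forall f : state R -> R, continuous f -> (exists M, forall x, `|f x| <= M) ->
    'E_P[f \o X t]%E @[t --> +oo] --> 'E_P'[f \o Y]%E.

(* Main.v *)
(** The tandem is compared from below with the chain on {0..K}^N in which
    arrivals are refused while the first queue equals K and the last site is
    served whenever it is not empty; by attractiveness Q dominates it.

    Let J be the stationary flux of this chain.  Stationarity of the sum of the
    squared queues shows that moves across a drop of at least two have bounded
    total rate.  Stationarity of the mean of ln p, where p is the stationary law,
    bounds an entropy production: every other move exchanges two neighbouring
    values, so p is almost invariant under exchanging neighbours that differ by
    one, on average over the sites.  Hence the parities of the queues at any two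
    sites of a long block differ with probability at least about 2J, while two
    parities picked at random in a block differ with probability at most 1/2.
    So J <= 1/4 + o(1) as N grows with K fixed, and the first queue equals K with
    probability at least about 1 - 1/(4 lambda), whatever K.

    This is upgraded to probability 1 as K grows: a stationary law weighted by a
    slowly varying function of the first queue is still almost stationary, hence
    dominates the minimal one, so that v = lim P(queue 1 >= k) satisfies
    v >= delta + (1 - delta) v.  A saturated site feeds the next one at rate
    1 > 1/4, which gives the other sites by induction.  The chain is embedded in
    the Poisson clocks by looking at the words of events on a fine time grid. *)
Require Import Defs.
From HB Require Import structures.
From mathcomp Require Import all_boot all_order all_algebra.
From mathcomp Require Import all_classical all_reals all_analysis.
From mathcomp Require Import zify ring lra.

Set Implicit Arguments.
Unset Strict Implicit.
Unset Printing Implicit Defensive.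

Import Order.TTheory GRing.Theory Num.Theory.
Import numFieldNormedType.Exports.
Local Open Scope classical_set_scope.
Local Open Scope ring_scope.

(** * Monotone finite chains *)

Section monotone_chain.
Variables (R : realType) (O C : finType) (r : C -> R) (phi : C -> O -> O).
Implicit Types (f g : O -> R) (p : O -> R) (x y : O).

Definition rate_sum : R := \sum_c r c.

Definition gen f x : R := \sum_c r c * (f (phi c x) - f x).

Definition kernel f x : R := (\sum_c r c * f (phi c x)) / rate_sum.

(** Invariance is stated through the generator; it amounts to invariance under the jump chain
    [kernel], since the events together occur at the constant rate [rate_sum]. *)
Definition stationary p : Prop :=
  [/\ forall x, 0 <= p x, \sum_x p x = 1 & forall f, \sum_x p x * gen f x = 0].

Variables (le : rel O) (bot : O).
Hypotheses (leO_refl : reflexive le) (leO_trans : transitive le).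
Hypothesis leO_anti : antisymmetric le.
Hypothesis le_bot : forall x, le bot x.
Hypothesis r_ge0 : forall c, 0 <= r c.
Hypothesis rate_gt0 : 0 < rate_sum.
Hypothesis phi_mono : forall c x y, le x y -> le (phi c x) (phi c y).

Definition increasing f : Prop := forall x y, le x y -> f x <= f y.

Lemma kernelE f x : kernel f x = f x + gen f x / rate_sum.
Proof.
rewrite /kernel /gen.
under [in RHS]eq_bigr do rewrite mulrBr.
rewrite sumrB -mulr_suml mulrBl -/rate_sum [in X in _ - X](mulrC rate_sum).
by rewrite mulfK ?gt_eqF // addrC subrK.
Qed.

Lemma kernel_le f g x : (forall y, f y <= g y) -> kernel f x <= kernel g x.
Proof.
move=> fg; rewrite ler_pM2r ?invr_gt0 //.
by apply: ler_sum => c _; apply: ler_wpM2l.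
Qed.

Lemma kernel_cst (a : R) x : kernel (fun=> a) x = a.
Proof. by rewrite /kernel -mulr_suml mulrAC divff ?mul1r ?gt_eqF. Qed.

Lemma kernel_increasing f : increasing f -> increasing (kernel f).
Proof.
move=> fi x y xy; rewrite ler_pM2r ?invr_gt0 //.
by apply: ler_sum => c _; apply: ler_wpM2l => //; apply/fi/phi_mono.
Qed.

Lemma iter_kernel_increasing f m : increasing f -> increasing (iter m kernel f).
Proof. by move=> fi; elim: m => //= m; apply: kernel_increasing. Qed.

Lemma kernel_bound (a b : R) f :
  (forall y, a <= f y <= b) -> forall x, a <= kernel f x <= b.
Proof.
move=> fab x; apply/andP; split.
  by rewrite -(kernel_cst a x); apply: kernel_le => y; case/andP: (fab y).
by rewrite -[leRHS](kernel_cst b x); apply: kernel_le => y; case/andP: (fab y).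
Qed.

Lemma iter_kernel_bound (a b : R) f m :
  (forall y, a <= f y <= b) -> forall x, a <= iter m kernel f x <= b.
Proof. by move=> fab; elim: m => //= m IH; apply: kernel_bound. Qed.

Lemma kernelB f g x : kernel (fun y => f y - g y) x = kernel f x - kernel g x.
Proof.
rewrite /kernel -mulrBl -sumrB; congr (_ / _).
by apply: eq_bigr => c _; rewrite mulrBr.
Qed.

Lemma eq_kernel f g : f =1 g -> kernel f =1 kernel g.
Proof. by move=> fg x; rewrite /kernel; under eq_bigr do rewrite fg. Qed.

Lemma eq_iter_kernel f g m : f =1 g -> iter m kernel f =1 iter m kernel g.
Proof. by move=> fg; elim: m => //= m IH; apply: eq_kernel. Qed.

Lemma iter_kernelB f g m x :
  iter m kernel (fun y => f y - g y) x = iter m kernel f x - iter m kernel g x.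
Proof.
by elim: m x => //= m IH x; rewrite (eq_kernel (g := fun y => _) IH) kernelB.
Qed.

Lemma kernel_sum (I : finType) (F : I -> O -> R) x :
  kernel (fun y => \sum_i F i y) x = \sum_i kernel (F i) x.
Proof.
rewrite /kernel -mulr_suml exchange_big; congr (_ / _).
by apply: eq_bigr => c _; rewrite mulr_sumr.
Qed.

Lemma iter_kernel_sum (I : finType) (F : I -> O -> R) m x :
  iter m kernel (fun y => \sum_i F i y) x = \sum_i iter m kernel (F i) x.
Proof.
by elim: m x => //= m IH x; rewrite (eq_kernel (g := fun y => _) IH) kernel_sum.
Qed.

Lemma kernelZ (a : R) f x : kernel (fun y => a * f y) x = a * kernel f x.
Proof.
rewrite /kernel mulrA mulr_sumr; congr (_ / _).
by apply: eq_bigr => c _; rewrite mulrCA.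
Qed.

Lemma iter_kernelZ (a : R) f m x :
  iter m kernel (fun y => a * f y) x = a * iter m kernel f x.
Proof.
by elim: m x => //= m IH x; rewrite (eq_kernel (g := fun y => _) IH) kernelZ.
Qed.

(** The move from [bot] can only go up, and the iterates of an increasing function remain
    increasing. *)
Lemma iter_kernel_bot_nondecreasing f :
  increasing f -> {homo (fun m => iter m kernel f bot) : m n / (m <= n)%N >-> m <= n}.
Proof.
move=> fi; apply: homo_leq => //; first by move=> ? ? ?; apply: le_trans.
move=> m; rewrite iterS -{1}[iter m _ _ bot](kernel_cst _ bot).
rewrite ler_pM2r ?invr_gt0 //; apply: ler_sum => c _; apply: ler_wpM2l => //.
exact: iter_kernel_increasing.
Qed.

Lemma iter_kernel_bot_cvg f (a b : R) : increasing f ->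
  (forall y, a <= f y <= b) -> cvgn (fun m => iter m kernel f bot).
Proof.
move=> fi fab; apply: nondecreasing_is_cvgn.
  exact: iter_kernel_bot_nondecreasing.
by exists b => _ [m _ <-]; case/andP: (iter_kernel_bound m fab bot).
Qed.

Let ind (A : pred O) : O -> R := fun y => (A y)%:R.

Let ind01 (A : pred O) y : 0 <= ind A y <= 1.
Proof. by rewrite /ind; case: (A y); rewrite !lexx ler01. Qed.

(** The indicator of a point is the difference of the indicators of two up-sets, above x and
    strictly above x, whose iterates at [bot] converge by monotonicity. *)
Lemma kernel_delta_cvg x :
  cvgn (fun m => iter m kernel (fun y => (y == x)%:R) bot).
Proof.
pose A := [pred y | le x y]; pose B := [pred y | le x y && (y != x)].
have iA : increasing (ind A).
  move=> y z yz; rewrite /ind /A /=; case: (boolP (le x y)) => [xy|_] /=.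
    by rewrite (leO_trans xy yz).
  by case: (le x z).
have iB : increasing (ind B).
  move=> y z yz; rewrite /ind /B /=; case: (boolP (le x y && (y != x))) => [|_].
    move=> /andP[xy yx]; rewrite (leO_trans xy yz) /=.
    case: eqVneq => // zx; subst z.
    by case/negP: yx; apply/eqP/leO_anti; rewrite yz xy.
  by case: (_ && _).
have E : (fun m => iter m kernel (fun y => (y == x)%:R) bot)
    = (fun m => iter m kernel (ind A) bot) \- (fun m => iter m kernel (ind B) bot).
  apply/funext => m /=; rewrite -iter_kernelB; apply: eq_iter_kernel => y.
  rewrite /ind /A /B /=; case: eqVneq => [->|_]; first by rewrite leO_refl subr0.
  by rewrite andbT subrr.
rewrite E; apply: is_cvgB; apply: iter_kernel_bot_cvg => //; exact: ind01.
Qed.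

(** [p x] is the limit of the probability of being at x after m jumps from [bot]. Shifting the
    sequence by one jump keeps the limit, which gives stationarity. The second part lets finitely
    many jumps replace the limit law. *)
Lemma stationary_limit : exists p, stationary p /\
  forall f (eps : R), 0 < eps ->
    exists m, `|\sum_x p x * f x - iter m kernel f bot| <= eps.
Proof.
pose q m x : R := iter m kernel (fun y => (y == x)%:R) bot.
pose p x := limn (q ^~ x).
have qp x : q ^~ x @ \oo --> p x by apply: kernel_delta_cvg.
have qE f m : iter m kernel f bot = \sum_x q m x * f x.
  rewrite (@eq_iter_kernel _ (fun y => \sum_x f x * (y == x)%:R)).
    rewrite iter_kernel_sum; apply: eq_bigr => x _.
    by rewrite iter_kernelZ mulrC.
  move=> y; rewrite (bigD1 y) //= eqxx mulr1 big1 ?addr0 // => x.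
  by rewrite eq_sym => /negbTE ->; rewrite mulr0.
have cv f : (fun m => iter m kernel f bot) @ \oo --> \sum_x p x * f x.
  under eq_fun do rewrite qE.
  apply: cvg_big => [|x _]; first exact: add_continuous.
  exact: cvgMr_tmp.
have uniq_lim f (l : R) : (fun m => iter m kernel f bot) @ \oo --> l ->
    l = \sum_x p x * f x.
  by move=> fl; apply: (cvg_unique _ fl (cv f)).
exists p; split; [split|].
- move=> x; rewrite /p; apply: limr_ge; first exact: qp.
  by apply: nearW => m; case/andP: (iter_kernel_bound m (ind01 (pred1 x)) bot).
- rewrite (eq_bigr (fun x => p x * 1)) => [|x _]; last by rewrite mulr1.
  rewrite -(uniq_lim (fun=> 1) 1) //.
  rewrite (_ : (fun m => _) = (fun=> 1)); first exact: cvg_cst.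
  apply/funext => m; apply/eqP; rewrite eq_le andbC.
  by apply: iter_kernel_bound => y; rewrite lexx.
- move=> f.
  have : \sum_x p x * f x = \sum_x p x * kernel f x.
    apply: uniq_lim.
    under eq_fun do rewrite -iterSr.
    have := cv f; rewrite -(cvg_shiftS (fun m => iter m kernel f bot)); exact.
  under [in RHS]eq_bigr do rewrite kernelE mulrDr mulrA.
  rewrite big_split /= -mulr_suml => /eqP.
  rewrite -subr_eq0 opprD addrA subrr sub0r oppr_eq0 mulf_eq0 invr_eq0.
  by rewrite (gt_eqF rate_gt0) orbF => /eqP.
- move=> f eps eps0; have /cvgrPdist_le/(_ _ eps0)[m _ /(_ m (leqnn m)) /=] := cv f.
  by exists m.
Qed.

Lemma stationary_kernel p g : stationary p ->
  \sum_x p x * kernel g x = \sum_x p x * g x.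
Proof.
move=> [_ _ ps]; under eq_bigr do rewrite kernelE mulrDr mulrA.
by rewrite big_split /= -mulr_suml ps mul0r addr0.
Qed.

(** Stationarity tested on the product of [w] and [f]: the weighted measure is invariant up to the
    variation of [w] along single moves, hence almost invariant for slowly varying [w]. *)
Lemma stationary_product p (w f : O -> R) : stationary p ->
  \sum_x (p x * w x) * gen f x =
  \sum_x p x * \sum_c r c * ((w x - w (phi c x)) * f (phi c x)).
Proof.
move=> [_ _ ps]; apply/eqP; rewrite -subr_eq0 -sumrB; apply/eqP.
rewrite -[RHS](ps (fun x => w x * f x)); apply: eq_bigr => x _.
rewrite -mulrA -mulrBr; congr (_ * _).
rewrite /gen mulr_sumr -sumrB; apply: eq_bigr => c _.
by rewrite mulrCA -mulrBr; congr (_ * _); ring.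
Qed.

Lemma stationary_support p c x : stationary p -> 0 < r c ->
  0 < p x -> 0 < p (phi c x).
Proof.
move=> pst rc px; have [p0 _ _] := pst.
pose g y : R := (y == phi c x)%:R.
have -> : p (phi c x) = \sum_y p y * g y.
  rewrite (bigD1 (phi c x)) //= /g eqxx mulr1 big1 ?addr0 // => y /negbTE ->.
  by rewrite mulr0.
rewrite -stationary_kernel //.
have k0 y : 0 <= kernel g y.
  by rewrite divr_ge0 ?(ltW rate_gt0) // sumr_ge0 // => i _; rewrite mulr_ge0 ?ler0n.
rewrite (bigD1 x) //=; apply: ltr_pwDl; last first.
  by rewrite sumr_ge0 // => y _; apply: mulr_ge0.
rewrite mulr_gt0 // divr_gt0 // (bigD1 c) //= /g eqxx mulr1; apply: ltr_pwDl => //.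
by rewrite sumr_ge0 // => i _; rewrite mulr_ge0 ?ler0n.
Qed.

(** Started from [p], the jump chain keeps its law, and every starting point lies above [bot]. So
    the limit law from [bot] is the smallest stationary one. *)
Lemma stationary_ge p f m : stationary p -> increasing f ->
  iter m kernel f bot <= \sum_x p x * f x.
Proof.
move=> pst fi; have [p0 p1 _] := pst.
have -> : \sum_x p x * f x = \sum_x p x * iter m kernel f x.
  by elim: m => //= m ->; rewrite stationary_kernel.
rewrite -[leLHS]mul1r -p1 mulr_suml; apply: ler_sum => x _.
by apply: ler_wpM2l => //; apply: iter_kernel_increasing.
Qed.

(** A robust form of [stationary_ge] for an unnormalised measure on another space, seen through
    [pr]: each jump raises the integral by at most [e / rate_sum], and after m jumps the starting
    points are compared with [bot]. *)
Lemma supersolution_ge (O' : finType) (nu : O' -> R) (pr : O' -> O) (e : R) m f :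
  (forall u, 0 <= nu u) ->
  (forall g, increasing g -> (forall y, 0 <= g y <= 1) ->
     \sum_u nu u * gen g (pr u) <= e) ->
  increasing f -> (forall y, 0 <= f y <= 1) ->
  (\sum_u nu u) * iter m kernel f bot
    <= \sum_u nu u * f (pr u) + m%:R * (e / rate_sum).
Proof.
move=> nu0 H; elim: m f => [|m IH] f fi f01.
  rewrite mul0r addr0 mulr_suml; apply: ler_sum => u _.
  by apply: ler_wpM2l => //; apply: fi.
rewrite iterSr (le_trans (IH _ (kernel_increasing fi) (kernel_bound f01))) //.
under eq_bigr do rewrite kernelE mulrDr mulrA.
rewrite big_split /= -mulr_suml.
have : (\sum_u nu u * gen f (pr u)) / rate_sum <= e / rate_sum.
  by rewrite ler_pM2r ?invr_gt0 //; apply: H.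
rewrite -natr1; lra.
Qed.

End monotone_chain.

(** * The truncated tandem *)

Definition arrive (z : nat -> nat) i := if i == 0%N then (z i).+1 else z i.

Definition serve n (z : nat -> nat) i :=
  if (z n.+1 < z n)%N then
    if i == n then (z i).-1 else if i == n.+1 then (z i).+1 else z i
  else z i.

(** Across a drop of one, service and exchange coincide; acting on rises of one as well turns the
    exchange into an involution. *)
Definition exchange n (z : nat -> nat) i :=
  if (z n == (z n.+1).+1) || (z n.+1 == (z n).+1) then
    if i == n then z n.+1 else if i == n.+1 then z n else z i
  else z i.

Definition config (N K : nat) : finType := {ffun 'I_N -> 'I_K.+1}.

Section configurations.
Variables (N K : nat).
Implicit Types (x y : config N K) (z : nat -> nat).

(* Sites beyond the last one count as empty, so that the last site of the
   finite tandem is served whenever it is not empty. *)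
Definition queue x (i : nat) : nat := oapp (fun j : 'I_N => x j : nat) 0%N (insub i).

(** Clipping at K refuses an arrival at a full first site. A service is not affected by it, since
    the receiving queue is strictly shorter than the sending one. *)
Definition config_of z : config N K := [ffun i : 'I_N => inord (minn (z i) K)].

Definition move (c : option 'I_N) x : config N K :=
  config_of (if c is Some n then serve n (queue x) else arrive (queue x)).

Definition swap n x : config N K := config_of (exchange n (queue x)).

Definition le_config : rel (config N K) := fun x y => [forall i, x i <= y i]%N.

Definition empty : config N K := config_of (fun=> 0%N).

Lemma queue_ord x (i : 'I_N) : queue x i = x i.
Proof. by rewrite /queue valK. Qed.

Lemma queue_out x i : (N <= i)%N -> queue x i = 0%N.
Proof. by move=> Ni; rewrite /queue insubF // ltnNge Ni. Qed.

Lemma queue_le x i : (queue x i <= K)%N.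
Proof. by rewrite /queue; case: insub => //= j; rewrite -ltnS. Qed.

Lemma queue_config_of z i :
  queue (config_of z) i = if (i < N)%N then minn (z i) K else 0%N.
Proof.
case: ltnP => iN; last exact: queue_out.
by rewrite (queue_ord _ (Ordinal iN)) ffunE /= inordK // ltnS geq_minr.
Qed.

Lemma queue_eqP x y : (forall i, (i < N)%N -> queue x i = queue y i) -> x = y.
Proof.
by move=> xy; apply/ffunP => i; apply/val_inj; rewrite /= -!queue_ord xy.
Qed.

Lemma le_configP x y :
  reflect (forall i, (i < N)%N -> (queue x i <= queue y i)%N) (le_config x y).
Proof.
apply: (iffP forallP) => [xy i iN | xy i].
  by rewrite !(queue_ord _ (Ordinal iN)).
by rewrite -!queue_ord xy.
Qed.

Lemma queue_empty i : queue empty i = 0%N.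
Proof. by rewrite queue_config_of min0n if_same. Qed.

Lemma le_config_refl : reflexive le_config.
Proof. by move=> x; apply/forallP. Qed.

Lemma le_config_trans : transitive le_config.
Proof.
by move=> y x z /forallP xy /forallP yz; apply/forallP => i; apply: leq_trans (yz i).
Qed.

Lemma le_config_anti : antisymmetric le_config.
Proof.
move=> x y /andP[/forallP xy /forallP yx]; apply/ffunP => i; apply/val_inj/eqP.
by rewrite eqn_leq xy yx.
Qed.

Lemma le_config_bot x : le_config empty x.
Proof. by apply/le_configP => i _; rewrite queue_empty. Qed.

Lemma queue_move_arrive x i :
  queue (move None x) i =
    if (i == 0%N) && (0 < N)%N then minn (queue x 0).+1 K else queue x i.
Proof.
rewrite queue_config_of /arrive; case: (posnP i) => [-> | i0] /=; case: ltnP => //.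
- by rewrite leqn0 => /eqP N0; rewrite queue_out ?N0.
- by move=> _; apply/minn_idPl/queue_le.
- by move=> iN; rewrite queue_out.
Qed.

Lemma queue_move_serve x (n : 'I_N) i :
  queue (move (Some n) x) i =
    if (queue x n.+1 < queue x n)%N then
      if i == n then (queue x n).-1
      else if (i == n.+1) && (n.+1 < N)%N then (queue x n.+1).+1 else queue x i
    else queue x i.
Proof.
rewrite queue_config_of /serve.
have qn := queue_le x n; have qn1 := queue_le x n.+1.
have qi := queue_le x i; have nN := ltn_ord n.
case: (ltnP (queue x n.+1)) => [lt_q|ge_q]; last first.
  by case: ltnP => [_|iN]; [apply/minn_idPl|rewrite queue_out].
case: (eqVneq i n) => [->|ni] /=; first by rewrite nN; lia.
case: (eqVneq i n.+1) => [->|ni1] /=.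
  by case: ltnP => [_|iN]; [lia|rewrite queue_out].
by case: ltnP => [_|iN]; [lia|rewrite queue_out].
Qed.

Lemma queue_swap x n i : (n.+1 < N)%N ->
  queue (swap n x) i =
    if (queue x n == (queue x n.+1).+1) || (queue x n.+1 == (queue x n).+1) then
      if i == n then queue x n.+1 else if i == n.+1 then queue x n else queue x i
    else queue x i.
Proof.
move=> nN; rewrite queue_config_of /exchange.
have qn := queue_le x n; have qn1 := queue_le x n.+1; have qi := queue_le x i.
case: ifP => iN.
  by case: ifP => _; [do 2?case: ifP => _|]; apply/minn_idPl.
have iN' : (N <= i)%N by rewrite leqNgt iN.
rewrite (queue_out x iN'); case: ifP => // _.
by case: eqVneq => [|_]; [lia|]; case: eqVneq => //; lia.
Qed.

Lemma swapK n : (n.+1 < N)%N -> involutive (swap n).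
Proof.
move=> nN x; apply: queue_eqP => i _; rewrite !queue_swap // !eqxx.
have -> : (n.+1 == n) = false by lia.
case: (boolP ((queue x n == _) || _)) => [E|E]; last by rewrite (negbTE E).
rewrite orbC E.
by case: eqVneq => [->//|_]; case: eqVneq => [->|].
Qed.

Lemma move_swap x (n : 'I_N) : (n.+1 < N)%N -> queue x n = (queue x n.+1).+1 ->
  move (Some n) x = swap n x.
Proof.
move=> nN E; apply: queue_eqP => i _.
rewrite queue_move_serve queue_swap // E ltnSn eqxx nN /= andbT.
by case: eqVneq => // _; case: eqVneq => // ->.
Qed.

(** Where a customer really moves, the move can be undone. Distinct configurations then have
    distinct images, whose total mass under a law is at most 1. *)
Lemma move_serve_inj (n : 'I_N) :
  {in [pred x | queue x n.+1 < queue x n]%N &, injective (move (Some n))}.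
Proof.
move=> x y; rewrite !inE => xn yn E.
have E' i := congr1 (queue ^~ i) E.
apply: queue_eqP => i iN; have := E' i; have := E' n.
rewrite !queue_move_serve xn yn eqxx.
case: (eqVneq i n) => [->|ni]; first by lia.
by case: (eqVneq i n.+1) iN => [->|ni1] //= ->; lia.
Qed.

Lemma move_arrive_inj : (0 < N)%N ->
  {in [pred x | queue x 0 < K]%N &, injective (move None)}.
Proof.
move=> N0 x y; rewrite !inE => x0 y0 E; apply: queue_eqP => i iN.
have := congr1 (queue ^~ i) E; rewrite !queue_move_arrive N0 andbT.
by case: eqVneq => [->|] //; lia.
Qed.

End configurations.

(** * Coupled moves of two tandems of different sizes *)

Section domination.
Variables (N K N' K' : nat).

Lemma move_serve_dom s (y : config N K) (x : config N' K') (n : 'I_N) (m : 'I_N') i :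
  m = (n + s)%N :> nat -> (i < N)%N -> (i + s < N')%N ->
  (forall j, (j < N)%N -> (queue y j <= queue x (j + s))%N) ->
  (queue (move (Some n) y) i <= queue (move (Some m) x) (i + s))%N.
Proof.
move=> mn iN isN' yx; have yxn := yx n (ltn_ord n); have yxi := yx i iN.
have yxn1 : (queue y n.+1 <= queue x m.+1)%N.
  case: (ltnP n.+1 N) => [/yx|nN]; last by rewrite queue_out.
  by rewrite mn addSn.
rewrite !queue_move_serve; rewrite -mn in yxn.
rewrite -(eqn_add2r s i n) -mn -(eqn_add2r s i n.+1) addSn -mn.
have [im|im] /= := eqVneq (i + s)%N m.
  have in_ : i = n by lia.
  rewrite im in_ in yxi *; case: (ltnP (queue y n.+1)); case: (ltnP (queue x m.+1)); lia.
have [im1|im1] /= := eqVneq (i + s)%N m.+1; last by rewrite !if_same.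
have in1 : i = n.+1 by lia.
have -> : (n.+1 < N)%N by rewrite -in1.
have -> : (m.+1 < N')%N by rewrite -im1.
rewrite im1 in1 in yxi *.
by case: (ltnP (queue y n.+1)); case: (ltnP (queue x m.+1)); lia.
Qed.

Lemma move_arrive_dom (y : config N K) (x : config N' K') i :
  (K <= K')%N -> (i < N')%N ->
  (forall j, (j < N)%N -> (queue y j <= queue x j)%N) -> (i < N)%N ->
  (queue (move None y) i <= queue (move None x) i)%N.
Proof.
move=> KK' iN' yx iN; have yx0 := yx 0%N; have := yx i iN.
rewrite !queue_move_arrive; case: eqVneq => [i0|] //=; subst i.
by rewrite iN iN'; lia.
Qed.

(* Service at the saturated first site of [x] feeds the rest of [x] as the
   arrivals feed [y]. *)
Lemma move_arrive_dom_shift (y : config N K) (x : config N' K') (m : 'I_N') i :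
  (m = 0 :> nat)%N -> (K < queue x 0)%N -> (i < N)%N -> (i.+1 < N')%N ->
  (forall j, (j < N)%N -> (queue y j <= queue x j.+1)%N) ->
  (queue (move None y) i <= queue (move (Some m) x) i.+1)%N.
Proof.
move=> m0 Kx iN i1N' yx; have := yx i iN; have := queue_le y i.
rewrite queue_move_arrive queue_move_serve m0.
case: (eqVneq i 0%N) => [i0|i0] /=; last by case: ifP => // _; case: eqVneq => //; lia.
subst i; rewrite iN i1N' /=.
by case: (ltnP (queue x 1)) => E; lia.
Qed.

End domination.

(** * Entropy estimates and generators *)

Lemma sum_option (V : nmodType) (I : finType) (F : option I -> V) :
  \sum_c F c = F None + \sum_i F (Some i).
Proof.
rewrite (bigD1 None) //=; congr (_ + _).
rewrite (reindex_omap Some id) => [|[]//].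
by apply: eq_bigl => i; rewrite /= eqxx.
Qed.

Section entropy_estimates.
Variable R : realType.
Implicit Types a b y M : R.

Lemma ln_le_sub1 (x : R) : 0 < x -> ln x <= x - 1.
Proof. by move=> x0; have := @le_ln1Dx R (x - 1); rewrite [1 + _]addrC subrK => ->//; lra. Qed.

(** The inequality ln t <= t - 1 at t = e^-M b / a. *)
Lemma entropy_le_shift a b M : 0 <= a -> 0 <= b -> (0 < a -> 0 < b) ->
  a * (ln b - ln a) <= a * M + expR (- M) * b.
Proof.
move=> a0 b0 ab; case: (ltrP 0 a) => [ap|]; last first.
  move=> an; have -> : a = 0 by apply/le_anti; rewrite an a0.
  by rewrite !mul0r add0r mulr_ge0 ?expR_ge0.
have bp := ab ap; have := @ln_le_sub1 (expR (- M) * b / a).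
rewrite !divr_gt0 ?mulr_gt0 ?expR_gt0 // => /(_ isT).
rewrite ln_div ?posrE ?mulr_gt0 ?expR_gt0 // lnM ?posrE ?expR_gt0 // expRK.
rewrite -(ler_pM2l ap) mulrBr (mulrBr a (_ / a)) [a * (_ / a)]mulrC mulfVK ?gt_eqF //.
rewrite mulr1; lra.
Qed.

(** With u, v the square roots of a, b, the inequality ln t <= t - 1 at t = v / u gives the bound (b
    - a) - (v - u)^2. The square is then linearised by (v - u)^2 >= y |b - a| - y^2 (u + v)^2 / 4,
    with y free. *)
Lemma entropy_le_tv a b y : 0 <= a -> 0 <= b -> (0 < a -> 0 < b) -> 0 <= y <= 1 ->
  a * (ln b - ln a) <= (b - a) - y * `|b - a| + y ^+ 2 / 2 * (a + b).
Proof.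
move=> a0 b0 ab /andP[y0 y1]; case: (ltrP 0 a) => [ap|]; last first.
  move=> an; have -> : a = 0 by apply/le_anti; rewrite an a0.
  rewrite mul0r !subr0 add0r ger0_norm // addr_ge0 //.
    by rewrite subr_ge0 ler_piMl.
  by rewrite mulr_ge0 ?divr_ge0 ?sqr_ge0.
have bp := ab ap.
set u := Num.sqrt a; set v := Num.sqrt b.
have up : 0 < u by rewrite sqrtr_gt0.
have vp : 0 < v by rewrite sqrtr_gt0.
have ua : a = u ^+ 2 by rewrite sqr_sqrtr.
have vb : b = v ^+ 2 by rewrite sqr_sqrtr.
rewrite ua vb !lnXn //.
have := @ln_le_sub1 (v / u); rewrite divr_gt0 // => /(_ isT).
rewrite ln_div ?posrE // -(ler_pM2l (exprn_gt0 2 up)) mulrBr [u ^+ 2 * (_ - 1)]mulrBr.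
have -> : u ^+ 2 * (v / u) = u * v by field; rewrite gt_eqF.
move=> H.
have -> : v ^+ 2 - u ^+ 2 = (v - u) * (v + u) by ring.
rewrite normrM (ger0_norm (_ : 0 <= v + u)); last lra.
set w := `|v - u|.
have w2 : w ^+ 2 = (v - u) ^+ 2 by rewrite real_normK ?num_real.
(* [p] and [q] stand for ln u and ln v. The slack is twice the slack of [H] plus two squares; the
   last summand vanishes because w = |v - u|. *)
have key (u' v' w' p q : R) : (v' - u') * (v' + u') - y * (w' * (v' + u'))
    + y ^+ 2 / 2 * (u' ^+ 2 + v' ^+ 2) - u' ^+ 2 * (2 * q - 2 * p)
  = 2 * ((u' * v' - u' ^+ 2 * 1) - (u' ^+ 2 * q - u' ^+ 2 * p))
    + (w' - y * (v' + u') / 2) ^+ 2 + (y * (v' - u') / 2) ^+ 2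
    + ((v' - u') ^+ 2 - w' ^+ 2) by field.
rewrite -subr_ge0 -[ln v *+ 2]mulr_natl -[ln u *+ 2]mulr_natl key.
rewrite w2 subrr addr0 !addr_ge0 ?sqr_ge0 // mulr_ge0 // subr_ge0.
exact: H.
Qed.

End entropy_estimates.

Definition rate (R : realType) (lam : R) N (c : option 'I_N) : R :=
  if c is Some _ then 1 else lam.

(** * The generator on additive functions *)

Section additive.
Variables (R : realType) (lam : R) (N K : nat).
Implicit Types x : config N K.

Lemma rate_sumE : rate_sum (rate lam (N := N)) = lam + N%:R.
Proof. by rewrite /rate_sum sum_option /= sumr_const card_ord. Qed.

Lemma genE (f : config N K -> R) x : gen (rate lam (N := N)) (@move N K) f x =
  lam * (f (move None x) - f x) + \sum_(n < N) (f (move (Some n) x) - f x).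
Proof. by rewrite /gen sum_option; under eq_bigr do rewrite mul1r. Qed.

Definition additive (psi : nat -> nat -> R) x : R := \sum_(j < N) psi j (queue x j).

Lemma gen_additive (psi : nat -> nat -> R) x : (0 < N)%N ->
  gen (rate lam (N := N)) (@move N K) (additive psi) x =
  lam * (psi 0%N (minn (queue x 0).+1 K) - psi 0%N (queue x 0)) +
  \sum_(n < N) if (queue x n.+1 < queue x n)%N then
    psi n (queue x n).-1 - psi n (queue x n) +
    (if (n.+1 < N)%N then psi n.+1 (queue x n.+1).+1 - psi n.+1 (queue x n.+1) else 0)
  else 0.
Proof.
move=> N0; rewrite genE /additive; congr (_ * _ + _).
  rewrite -sumrB (bigD1 (Ordinal N0)) //= big1 ?addr0 => [|j j0].
    by rewrite queue_move_arrive eqxx N0.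
  rewrite queue_move_arrive; case: eqVneq => [E|]; last by rewrite subrr.
  by case/eqP: j0; apply: val_inj.
apply: eq_bigr => n _; rewrite -sumrB (bigD1 n) //= queue_move_serve eqxx.
case: (ltnP (queue x n.+1)) => qn; last first.
  rewrite subrr add0r big1 // => j _; rewrite queue_move_serve ltnNge qn /=.
  by rewrite subrr.
congr (_ + _); case: (ltnP n.+1 N) => nN.
  have nn1 : n.+1 == n = false by lia.
  rewrite (bigD1 (Ordinal nN)) /= -?val_eqE /= ?nn1 // big1 ?addr0 => [|j].
    by rewrite queue_move_serve qn nn1 eqxx nN.
  rewrite -!val_eqE /= => /andP[jn jn1].
  by rewrite queue_move_serve qn (negbTE jn) (negbTE jn1) subrr.
rewrite big1 // => j jn.
by rewrite queue_move_serve qn val_eqE (negbTE jn) andbC ltnNge nN subrr.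
Qed.

End additive.

(** * The flux of the stationary tandem *)

Section stationary_tandem.
Variables (R : realType) (lam : R) (L K : nat) (p : config L.+1 K -> R).
Hypotheses (lam_gt0 : 0 < lam).
Hypothesis pst : stationary (rate lam (N := L.+1)) (@move L.+1 K) p.
Implicit Types (x : config L.+1 K) (f g : config L.+1 K -> R).
Implicit Types (A : pred (config L.+1 K)) (b : nat).

Local Notation N := L.+1.

Definition mean f : R := \sum_x p x * f x.
Definition prob A : R := \sum_(x | A x) p x.

Definition served n : pred (config N K) := fun x => (queue x n.+1 < queue x n)%N.
Definition down1 b : pred (config N K) := fun x => queue x b == (queue x b.+1).+1.
Definition up1 b : pred (config N K) := fun x => queue x b.+1 == (queue x b).+1.
Definition drop2 b : pred (config N K) := fun x => (queue x b.+1 + 2 <= queue x b)%N.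
Definition rise2 b : pred (config N K) := fun x => (queue x b + 2 <= queue x b.+1)%N.
(** Both truncations are meant: this is the positive part of the drop minus one, half the loss of
    the sum of squares when a customer crosses the bond. *)
Definition excess b x : R := (queue x b - queue x b.+1).-1%:R.

Definition throughput : R := lam * prob (fun x => queue x 0 < K)%N.

Lemma p_ge0 x : 0 <= p x. Proof. by case: pst. Qed.

Lemma p_sum1 : \sum_x p x = 1. Proof. by case: pst. Qed.

Lemma mean_gen f : mean (gen (rate lam (N := N)) (@move N K) f) = 0.
Proof. by case: pst => _ _; apply. Qed.

Lemma mean_le f g : (forall x, f x <= g x) -> mean f <= mean g.
Proof. by move=> fg; apply: ler_sum => x _; rewrite ler_wpM2l ?p_ge0. Qed.

Lemma eq_mean f g : f =1 g -> mean f = mean g.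
Proof. by move=> fg; apply: eq_bigr => x _; rewrite fg. Qed.

Lemma meanD f g : mean (fun x => f x + g x) = mean f + mean g.
Proof. by rewrite -big_split; apply: eq_bigr => x _; rewrite mulrDr. Qed.

Lemma meanB f g : mean (fun x => f x - g x) = mean f - mean g.
Proof. by rewrite -sumrB; apply: eq_bigr => x _; rewrite mulrBr. Qed.

Lemma meanZ (a : R) f : mean (fun x => a * f x) = a * mean f.
Proof. by rewrite /mean mulr_sumr; apply: eq_bigr => x _; rewrite mulrCA. Qed.

Lemma mean_cst (a : R) : mean (fun=> a) = a.
Proof. by rewrite /mean -mulr_suml p_sum1 mul1r. Qed.

Lemma mean_sum (I : finType) (F : I -> config N K -> R) :
  mean (fun x => \sum_i F i x) = \sum_i mean (F i).
Proof.
rewrite /mean exchange_big; apply: eq_bigr => x _ /=.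
by rewrite mulr_sumr.
Qed.

Lemma mean_ind A : mean (fun x => (A x)%:R) = prob A.
Proof.
rewrite /prob [RHS]big_mkcond; apply: eq_bigr => x _.
by case: (A x); rewrite ?mulr1 ?mulr0.
Qed.

Lemma prob_ge0 A : 0 <= prob A.
Proof. by apply: sumr_ge0 => x _; apply: p_ge0. Qed.

Lemma prob_le1 A : prob A <= 1.
Proof.
rewrite -mean_ind -[leRHS](mean_cst 1); apply: mean_le => x.
by rewrite lern1; case: (A x).
Qed.

Lemma rate_gt0 c : 0 < rate lam (N := N) c.
Proof. by case: c => [?|] /=. Qed.

Lemma rate_sum_gt0 : 0 < rate_sum (rate lam (N := N)).
Proof. by rewrite rate_sumE addr_gt0 ?ltr0n. Qed.

Lemma flux n : (n < N)%N -> prob (served n) = throughput.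
Proof.
move=> nN; pose psi j v : R := (j <= n)%N%:R * v%:R.
have E x : gen (rate lam (N := N)) (@move N K) (additive psi) x
    = lam * (queue x 0 < K)%N%:R - (served n x)%:R.
  rewrite gen_additive // /psi /= !mul1r; congr (_ * _ + _).
    have q0 := queue_le x 0; case: ltnP => [/minn_idPl ->|Kq].
      by rewrite -natr1 addrAC subrr add0r.
    rewrite (minn_idPr _) ?(leq_trans Kq) // (_ : queue x 0 = K) ?subrr //.
    by apply/eqP; rewrite eqn_leq q0.
  rewrite (bigD1 (Ordinal nN)) //= big1 => [|j jn].
    rewrite leqnn ltnn !mul0r subrr if_same addr0 !mul1r addr0.
    rewrite /served; case: ltnP => [lt_q|]; last by rewrite oppr0.
    by case: (queue x n) lt_q => //= v _; rewrite -natr1; ring.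
  case: ltnP => // qj; have {}jn : j != n :> nat by [].
  case: (ltngtP j n) jn => //= jn _.
    rewrite (leq_ltn_trans jn nN) !mul1r -(natr1 (queue x j.+1)).
    by case: (queue x j) qj => //= v _; rewrite -natr1; ring.
  by rewrite !mul0r subrr add0r if_same.
have := mean_gen (additive psi); rewrite (eq_mean E) meanB meanZ !mean_ind => /eqP.
by rewrite subr_eq0 => /eqP <-.
Qed.

(** A move across a drop d lowers the sum of squares by 2 (d - 1), an arrival raises it by at most 2
    K + 1, and a departure from the last site lowers it. *)
Lemma energy_bound : \sum_(b < L) mean (excess b) <= lam * K.+1%:R.
Proof.
pose psi (j v : nat) : R := v%:R ^+ 2.
have := mean_gen (additive psi); set f := gen _ _ _ => f0.
have : mean f <= mean (fun x => 2 * (lam * K.+1%:R) - 2 * \sum_(b < L) excess b x).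
  apply: mean_le => x; rewrite /f gen_additive // /psi /=.
  have -> : 2 * (lam * K.+1%:R) = lam * (2 * K.+1%:R) by ring.
  rewrite big_ord_recr /= ltnn.
  apply: lerD.
    rewrite ler_pM2l //; have q0 := queue_le x 0.
    apply: (@le_trans _ _ ((queue x 0).+1%:R ^+ 2 - (queue x 0)%:R ^+ 2)).
      by rewrite lerB // lerXn2r ?nnegrE ?ler0n // ler_nat geq_minl.
    have : (queue x 0)%:R <= K%:R :> R by rewrite ler_nat.
    rewrite -!natr1; nra.
  rewrite -[leRHS]addr0; apply: lerD; last first.
    case: ltnP => // qL; rewrite addr0 subr_le0 lerXn2r ?nnegrE ?ler0n //.
    by rewrite ler_nat leq_pred.
  rewrite mulr_sumr -sumrN; apply: ler_sum => b _; rewrite /excess ltnS ltn_ord.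
  case: ltnP => [lt_q|ge_q]; last first.
    by rewrite (eqP (ge_q : _ - _ == 0)%N) /= mulr0 oppr0.
  have [u ->] : exists u, queue x b = (queue x b.+1 + u).+1.
    by exists (queue x b - queue x b.+1).-1; lia.
  rewrite (_ : (queue x b.+1 + u).+1 - _ = u.+1)%N /=; last by lia.
  by rewrite -!natr1 natrD; lra.
rewrite f0 meanB mean_cst meanZ mean_sum; lra.
Qed.


(** * Entropy production and approximate exchange invariance *)

Lemma sum_inj_le1 A (h : config N K -> config N K) :
  {in A &, injective h} -> \sum_(x | A x) p (h x) <= 1.
Proof.
move=> hi; rewrite -p_sum1 -(big_imset p hi) /= [leRHS](bigID (mem [set h x | x in A]%SET)) /=.
by rewrite lerDl sumr_ge0 // => x _; apply: p_ge0.
Qed.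

(** Twice the total variation distance between [p] and its image under the involution [swap b]. *)
Definition tv b : R := \sum_x `|p (swap b x) - p x|.

Lemma down1_swap b x : (b < L)%N -> down1 b (swap b x) = up1 b x.
Proof.
move=> bL; rewrite /down1 /up1 !queue_swap // !eqxx.
have -> : (b.+1 == b) = false by lia.
by case: (boolP ((queue x b == _) || _)) => // /norP[/negbTE -> /negbTE ->].
Qed.

Lemma sum_down1_swap b f : (b < L)%N ->
  \sum_(x | down1 b x) f (swap b x) = \sum_(x | up1 b x) f x.
Proof.
move=> bL; rewrite (reindex_inj (inv_inj (@swapK L.+1 K b bL))) /=.
by apply: eq_big => x; rewrite ?down1_swap // swapK.
Qed.

(** The swap matches the drops of one with the rises of one and fixes every other configuration. *)
Lemma tvE b : (b < L)%N -> tv b = 2 * \sum_(x | down1 b x) `|p (swap b x) - p x|.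
Proof.
move=> bL; rewrite /tv (bigID (down1 b)) /= mulr2n mulrDl !mul1r; congr (_ + _).
rewrite (bigID (up1 b)) /= [X in _ + X]big1 ?addr0; last first.
  move=> x /andP[nd nu]; rewrite (_ : swap b x = x) ?subrr ?normr0 //.
  apply: queue_eqP => i _; rewrite queue_swap //.
  by move: nd nu; rewrite /down1 /up1 => /negbTE -> /negbTE ->.
rewrite (eq_bigl (up1 b)) => [|x]; last first.
  by rewrite /down1 /up1; case: eqVneq => //= ->; lia.
rewrite -sum_down1_swap //; apply: eq_bigr => x _.
by rewrite swapK // distrC.
Qed.

(** Up to its rate, the contribution of the move c to the mean of the generator at ln p. If p x = 0
    the term vanishes; otherwise p is positive at the image too, by [p_move_gt0], so the default
    value of ln at 0 has no effect. *)
Definition entropy_drift c x : R := p x * (ln (p (move c x)) - ln (p x)).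

Lemma sum_entropy_drift :
  lam * \sum_x entropy_drift None x + \sum_(n < N) \sum_x entropy_drift (Some n) x = 0.
Proof.
rewrite -[RHS](mean_gen (fun x => ln (p x))) exchange_big /= mulr_sumr -big_split.
apply: eq_bigr => x _; rewrite genE mulrDr mulr_sumr; congr (_ + _).
by rewrite /entropy_drift mulrCA.
Qed.

Lemma entropy_drift_id c x : move c x = x -> entropy_drift c x = 0.
Proof. by rewrite /entropy_drift => ->; rewrite subrr mulr0. Qed.

Lemma p_move_gt0 c x : 0 < p x -> 0 < p (move c x).
Proof.
apply: (stationary_support _ _ pst); last exact: rate_gt0.
- by move=> c'; rewrite ltW ?rate_gt0.
- exact: rate_sum_gt0.
Qed.

Lemma entropy_drift_le c x : entropy_drift c x <= p (move c x).
Proof.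
have := entropy_le_shift 0 (p_ge0 x) (p_ge0 (move c x)) (@p_move_gt0 c x).
by rewrite oppr0 expR0 mulr0 mul1r add0r.
Qed.

Lemma entropy_drift_arrive : \sum_x entropy_drift None x <= 1.
Proof.
rewrite (bigID (fun x => queue x 0 < K)%N) /= [X in _ + X]big1 => [|x Kq].
  rewrite addr0; apply: (@le_trans _ _ (\sum_(x | (queue x 0 < K)%N) p (move None x))).
    by apply: ler_sum => x _; apply: entropy_drift_le.
  exact/sum_inj_le1/move_arrive_inj.
apply: entropy_drift_id; apply: queue_eqP => i _; rewrite queue_move_arrive andbT.
by have := queue_le x 0; case: eqVneq => // ->; lia.
Qed.

Lemma move_serve_id (n : 'I_N) x : ~~ served n x -> move (Some n) x = x.
Proof.
by move=> /negbTE ns; apply: queue_eqP => i _; rewrite queue_move_serve -/(served n x) ns.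
Qed.

Lemma entropy_drift_serve (n : 'I_N) : \sum_x entropy_drift (Some n) x <= 1.
Proof.
rewrite (bigID (served n)) /= [X in _ + X]big1 => [|x /move_serve_id]; last first.
  exact: entropy_drift_id.
rewrite addr0; apply: (@le_trans _ _ (\sum_(x | served n x) p (move (Some n) x))).
  by apply: ler_sum => x _; apply: entropy_drift_le.
exact/sum_inj_le1/move_serve_inj.
Qed.

(* Moves across a drop of at least two are not reversible: each is charged M,
   which is affordable because their total rate is bounded, and the error e^-M
   per bond is small for M large. *)
Lemma entropy_drift_bond (n : 'I_N) (y M : R) : 0 <= y <= 1 -> (n < L)%N ->
  \sum_x entropy_drift (Some n) x <=
    prob (drop2 n) * M + expR (- M) + (prob (up1 n) - prob (down1 n))
    - y / 2 * tv n + y ^+ 2 / 2.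
Proof.
move=> y01 nL; rewrite (bigID (drop2 n)) /= -!addrA [leRHS]addrA; apply: lerD.
  apply: (@le_trans _ _ (\sum_(x | drop2 n x) (p x * M + expR (- M) * p (move (Some n) x)))).
    by apply: ler_sum => x _; apply: entropy_le_shift; rewrite ?p_ge0 //; apply: p_move_gt0.
  rewrite big_split /= -mulr_suml -mulr_sumr lerD2l ler_piMr ?expR_ge0 //.
  apply: sum_inj_le1 => u v; rewrite !unfold_in /drop2 => uA vA.
  by apply: move_serve_inj; rewrite inE; lia.
rewrite (bigID (down1 n)) /= [X in _ + X]big1 ?addr0; last first.
  move=> x /andP[nd nd1]; apply/entropy_drift_id/move_serve_id.
  by move: nd nd1; rewrite /drop2 /down1 /served; lia.
rewrite (eq_bigl (down1 n)); last first.
  by move=> x; rewrite /drop2 /down1; lia.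
(* Across a drop of exactly one, service is the exchange. The differences sum to the probability of
   [up1] minus that of [down1], the absolute values to half of [tv], and the remaining masses to at
   most 1. *)
apply: (@le_trans _ _ (\sum_(x | down1 n x) ((p (swap n x) - p x)
    - y * `|p (swap n x) - p x| + y ^+ 2 / 2 * (p x + p (swap n x))))).
  apply: ler_sum => x /eqP d1; rewrite /entropy_drift move_swap //.
  apply: entropy_le_tv; rewrite ?p_ge0 // => px.
  by rewrite -move_swap // p_move_gt0.
rewrite !big_split /= sumrN -mulr_sumr sumrN -mulr_sumr big_split /=.
rewrite (sum_down1_swap p nL) -/(prob _) -/(prob _).
have -> : y / 2 * tv n = y * \sum_(x | down1 n x) `|p (swap n x) - p x|.
  by rewrite tvE // mulrA divfK // pnatr_eq0.
rewrite !addrA lerD2l ler_piMr ?divr_ge0 ?sqr_ge0 //.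
rewrite -(mean_ind (down1 n)) -(mean_ind (up1 n)) -meanD -[leRHS](mean_cst 1).
apply: mean_le => x; rewrite /down1 /up1.
by case: eqVneq => [->|_]; case: eqVneq => [E|_]; rewrite ?addr0 ?add0r //=; lia.
Qed.

(** With d the drop across the bond, the right side is d - 2 when d >= 2 and - d otherwise. In this
    form the differences telescope over the bonds. *)
Lemma displacement_bond b x :
  (up1 b x)%:R - (down1 b x)%:R + (rise2 b x)%:R
    <= (queue x b.+1)%:R - (queue x b)%:R + 2 * excess b x.
Proof.
rewrite /up1 /down1 /rise2 /excess; move: (queue x b) (queue x b.+1) => u v.
case: (ltngtP u v) => [uv|vu|->].
- have -> : (u == v.+1) = false by lia.
  have -> : ((u - v).-1 = 0)%N by lia.
  have [w ->] : exists w, v = (u + w).+1 by exists (v - u).-1; lia.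
  have -> : (u + 2 <= (u + w).+1)%N = (0 < w)%N by lia.
  rewrite eqSS -[X in _ == X]addn0 eqn_add2l.
  rewrite mulr0 addr0 subr0 -natr1 natrD.
  by case: w => [|w] /=; [lra|have := ler0n R w; rewrite -natr1; lra].
- have -> : (v == u.+1) = false by lia.
  have -> : (u + 2 <= v)%N = false by lia.
  have [w ->] : exists w, u = (v + w).+1 by exists (u - v).-1; lia.
  have -> : ((v + w).+1 - v).-1%N = w by lia.
  rewrite eqSS -[X in _ == X]addn0 eqn_add2l -natr1 natrD.
  by case: w => [|w] /=; [lra|have := ler0n R w; rewrite -natr1; lra].
- have -> : (v == v.+1) = false by lia.
  by rewrite (_ : (v + 2 <= v)%N = false) ?subnn /=; [lra|lia].
Qed.

(** The differences telescope to at most K and [energy_bound] controls the excesses. This bounds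
    jointly, free of L, the linear terms of the entropy estimate and the probabilities of large
    rises. *)
Lemma displacement_bound :
  \sum_(b < L) (prob (up1 b) - prob (down1 b)) + \sum_(b < L) prob (rise2 b)
    <= K%:R + 2 * (lam * K.+1%:R).
Proof.
rewrite -big_split /=.
have -> : \sum_(b < L) (prob (up1 b) - prob (down1 b) + prob (rise2 b))
  = mean (fun x => \sum_(b < L) ((up1 b x)%:R - (down1 b x)%:R + (rise2 b x)%:R)).
  by rewrite mean_sum; apply: eq_bigr => b _; rewrite meanD meanB !mean_ind.
apply: (@le_trans _ _ (mean (fun x => K%:R + 2 * \sum_(b < L) excess b x))).
  apply: mean_le => x; apply: (@le_trans _ _ (\sum_(b < L)
      ((queue x b.+1)%:R - (queue x b)%:R + 2 * excess b x))).
    by apply: ler_sum => b _; apply: displacement_bond.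
  rewrite big_split /= -mulr_sumr lerD2r.
  rewrite -(big_mkord xpredT (fun b => (queue x b.+1)%:R - (queue x b)%:R)).
  rewrite (telescope_sumr (fun b => (queue x b)%:R)) //.
  by rewrite lerBlDr ler_wpDr ?ler0n // ler_nat queue_le.
rewrite meanD mean_cst meanZ mean_sum lerD2l ler_pM2l //.
exact: energy_bound.
Qed.

Lemma drop2_bound : \sum_(b < L) prob (drop2 b) <= lam * K.+1%:R.
Proof.
apply: le_trans energy_bound; apply: ler_sum => b _.
rewrite -mean_ind; apply: mean_le => x; rewrite /drop2 /excess ler_nat.
by case: leqP => //; lia.
Qed.

(* Measures the failure of invariance under the exchange of the sites b and
   b + 1; its sum over the bonds is sublinear in their number. *)
Definition roughness b : R := tv b + prob (rise2 b) + prob (drop2 b).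

Lemma roughness_ge0 b : 0 <= roughness b.
Proof. by rewrite !addr_ge0 ?prob_ge0 // sumr_ge0. Qed.

(** The bond estimates are summed with at most lambda for the arrivals and 1 for the last site;
    since the total entropy drift is zero, this isolates the sum of [tv]. Only the last term grows
    with L, and y and M make it small per bond. *)
Lemma roughness_bound (y M : R) : 0 <= y <= 1 -> 0 <= M ->
  y / 2 * \sum_(b < L) roughness b <=
    lam + 1 + K%:R + lam * K.+1%:R * (M + 3) + L%:R * (expR (- M) + y ^+ 2 / 2).
Proof.
move=> y01 M0; have /andP[y0 y1] := y01; have := sum_entropy_drift.
rewrite big_ord_recr /=.
have HN : lam * \sum_x entropy_drift None x <= lam.
  by rewrite ler_piMr ?entropy_drift_arrive // ltW.
have HL := entropy_drift_serve (ord_max : 'I_N).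
have Hb : \sum_(b < L) \sum_x entropy_drift (Some (widen_ord (leqnSn L) b)) x <=
    (\sum_(b < L) prob (drop2 b)) * M
    + \sum_(b < L) (prob (up1 b) - prob (down1 b))
    - y / 2 * \sum_(b < L) tv b + L%:R * (expR (- M) + y ^+ 2 / 2).
  apply: (@le_trans _ _ (\sum_(b < L) (prob (drop2 b) * M + expR (- M)
      + (prob (up1 b) - prob (down1 b)) - y / 2 * tv b + y ^+ 2 / 2))).
    by apply: ler_sum => b _; apply: entropy_drift_bond => /=.
  rewrite mulr_suml mulr_sumr -sumrN mulr_natl -[L in X in _ + X]card_ord.
  rewrite -sumr_const -!big_split /= ler_sum // => b _; lra.
have Hd : (\sum_(b < L) prob (drop2 b)) * M <= lam * K.+1%:R * M.
  by rewrite ler_wpM2r ?drop2_bound.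
have Hr : y / 2 * \sum_(b < L) prob (rise2 b) <= \sum_(b < L) prob (rise2 b).
  by rewrite ler_piMl ?sumr_ge0 ?(mulr_ge0, invr_ge0) // => [b _|]; [exact: prob_ge0|lra].
have Hq : y / 2 * \sum_(b < L) prob (drop2 b) <= \sum_(b < L) prob (drop2 b).
  by rewrite ler_piMl ?sumr_ge0 ?(mulr_ge0, invr_ge0) // => [b _|]; [exact: prob_ge0|lra].
have Hdis := displacement_bound; have Hdr := drop2_bound.
rewrite /roughness !big_split /= !mulrDr.
set C := lam * K.+1%:R in Hd Hdis Hdr *.
move: Hdr Hdis Hr Hq Hd HN HL Hb.
move: (\sum_(b < L) prob (rise2 b)) (\sum_(b < L) prob (drop2 b)) => r2 d2.
move: (\sum_(b < L) tv b) (\sum_(b < L) (prob (up1 b) - prob (down1 b))) => tvs ud.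
move: (\sum_(b < L) \sum_x _) (\sum_x _) (lam * _) => s1 s2 s3.
move=> *; lra.
Qed.

(** * Parities of the queues in a block *)

Definition parity_differ i j : pred (config N K) :=
  fun x => odd (queue x i) != odd (queue x j).

Lemma mean_swap A b : (b < L)%N ->
  prob A <= prob (fun x => A (swap b x)) + tv b.
Proof.
move=> bL.
have -> : prob (fun x => A (swap b x)) = \sum_(x | A x) p (swap b x).
  rewrite /prob [RHS](reindex_inj (inv_inj (@swapK L.+1 K b bL))) /=.
  by apply: eq_bigr => x _; rewrite swapK.
rewrite -lerBlDl -sumrB (le_trans (ler_norm _)) // (le_trans (ler_norm_sum _ _ _)) //.
rewrite /tv [leRHS](bigID A) /= ler_wpDr ?sumr_ge0 //.
by apply: ler_sum => x _; rewrite distrC.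
Qed.

(** Up to roughness, a served customer crosses a drop of exactly one, and by exchange a rise of one
    is as likely. Both events make the neighbouring parities differ, whence the factor 2. *)
Lemma parity_differ_bond i : (i < L)%N ->
  2 * throughput <= prob (parity_differ i i.+1) + 2 * roughness i.
Proof.
move=> iL; rewrite -(flux (ltn_trans iL (ltnSn L))).
have Hs : prob (served i) <= prob (down1 i) + prob (drop2 i).
  rewrite -!mean_ind -meanD; apply: mean_le => x.
  rewrite /served /down1 /drop2 -natrD ler_nat.
  by case: ltnP => //= lt_q; case: eqVneq => //= ne; lia.
have Hd : prob (down1 i) <= prob (up1 i) + tv i.
  rewrite (le_trans (mean_swap _ iL)) // lerD2r le_eqVlt; apply/orP; left.
  by apply/eqP/eq_bigl => x; rewrite down1_swap.
have Hp : prob (up1 i) + prob (down1 i) <= prob (parity_differ i i.+1).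
  rewrite -!mean_ind -meanD; apply: mean_le => x.
  rewrite /up1 /down1 /parity_differ -natrD ler_nat.
  case: eqVneq => [->|_] /=.
    by case: (odd _); case: eqVneq => [|_] //=; lia.
  by case: eqVneq => [->|//] /=; case: (odd _).
have := prob_ge0 (rise2 i); have := prob_ge0 (drop2 i).
have : 0 <= tv i by apply: sumr_ge0.
rewrite /roughness; lra.
Qed.

(* Neighbours that differ by at most one are exchanged by [swap j]; so the site
   compared with i can be moved one step away. *)
Lemma parity_differ_transport i j : (i < j)%N -> (j < L)%N ->
  prob (parity_differ i j) <= prob (parity_differ i j.+1) + roughness j.
Proof.
move=> ij jL; rewrite (le_trans (mean_swap _ jL)) //.
suff : prob (fun x => parity_differ i j (swap j x)) <=
    prob (parity_differ i j.+1) + prob (rise2 j) + prob (drop2 j).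
  by rewrite /roughness; lra.
rewrite -!mean_ind -!meanD; apply: mean_le => x.
rewrite -!natrD ler_nat /parity_differ !queue_swap // eqxx.
rewrite /rise2 /drop2.
have -> : (i == j) = false by lia.
have -> : (i == j.+1) = false by lia.
rewrite if_same; case: ifPn => nd; first by rewrite -addnA leq_addr.
have [jj1|/eqP jj1] := eqVneq (queue x j) (queue x j.+1).
  by rewrite jj1 -addnA leq_addr.
apply: (@leq_trans 1); first by case: (_ != _).
rewrite -addnA; apply: leq_trans (leq_addl _ _).
case/norP: nd => /eqP uv /eqP vu; move: uv vu jj1.
move: (queue x j) (queue x j.+1) => u v uv vu ne.
have [->|->] : (u + 2 <= v)%N \/ (v + 2 <= u)%N by lia.
  exact: leq_addr.
exact: leq_addl.
Qed.

(** Induction on j from the neighbouring case, paying the roughness of one more bond at each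
    step. *)
Lemma parity_differ_far i j : (i < j)%N -> (j < N)%N ->
  2 * throughput <= prob (parity_differ i j) + 2 * \sum_(i <= b < j) roughness b.
Proof.
elim: j => // j IH ij jN.
have [->|ne] := eqVneq i j.
  by rewrite big_nat1 parity_differ_bond // -ltnS (leq_trans _ jN) // ltnS.
have {}ij : (i < j)%N by lia.
have jL : (j < L)%N by lia.
have := IH ij (ltnW jN); have := parity_differ_transport ij jL.
have := roughness_ge0 j.
rewrite big_nat_recr ?(ltnW ij) //=; lra.
Qed.

(** With t odd values among n, the ordered pairs of unlike parity number 2 t (n - t) <= n^2 / 2. *)
Lemma parity_pairs (I : finType) (o : I -> bool) :
  \sum_i \sum_j (o i != o j)%:R <= #|I|%:R ^+ 2 / 2 :> R.
Proof.
pose t : R := \sum_i (o i)%:R.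
have -> : \sum_i \sum_j (o i != o j)%:R = 2 * (#|I|%:R * t) - 2 * t ^+ 2 :> R.
  have E i : \sum_j (o i != o j)%:R = #|I|%:R * (o i)%:R + t - 2 * ((o i)%:R * t) :> R.
    rewrite /t mulr_natl -(sumr_const I) 2!mulr_sumr -big_split -sumrB.
    by apply: eq_big => // j _; case: (o i); case: (o j); rewrite /=; lra.
  under eq_bigr do rewrite E.
  rewrite sumrB big_split /= -mulr_sumr sumr_const -mulr_sumr -mulr_suml -/t.
  by rewrite -[t *+ _]mulr_natl; ring.
by have := sqr_ge0 (#|I|%:R - 2 * t); lra.
Qed.

(** The estimate for distant sites is averaged over all ordered pairs in a block of l sites. The l
    diagonal pairs, where the throughput is only bounded by 1, cost 1 / l. *)
Lemma throughput_block s l : (0 < l)%N -> (s + l <= N)%N ->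
  throughput <= 4^-1 + l%:R^-1 + \sum_(s <= b < s + l) roughness b.
Proof.
move=> l0 slN; set E := \sum_(s <= b < s + l) _.
have E0 : 0 <= E by apply: sumr_ge0 => b _; apply: roughness_ge0.
have lr0 : 0 < l%:R :> R by rewrite ltr0n.
have sub i j : (i < j)%N -> (j < l)%N ->
    2 * throughput <= prob (parity_differ (s + i) (s + j)) + 2 * E.
  move=> ij jl; have := @parity_differ_far (s + i) (s + j).
  rewrite ltn_add2l ij (leq_trans _ slN) ?ltn_add2l // => /(_ isT isT).
  move=> /le_trans; apply; rewrite lerD2l ler_pM2l //.
  have lower m n o : (m <= n)%N -> (n <= o)%N ->
      \sum_(n <= b < o) roughness b <= \sum_(m <= b < o) roughness b.
    move=> mn no; rewrite (@big_cat_nat _ _ _ n m o) //=.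
    by rewrite lerDr sumr_ge0 // => b _; apply: roughness_ge0.
  have upper m n o : (m <= n)%N -> (n <= o)%N ->
      \sum_(m <= b < n) roughness b <= \sum_(m <= b < o) roughness b.
    move=> mn no; rewrite (@big_cat_nat _ _ _ n m o) //=.
    by rewrite lerDl sumr_ge0 // => b _; apply: roughness_ge0.
  apply: le_trans (upper _ _ (s + l)%N _ _) (lower _ _ _ _ _); lia.
have pair (i j : 'I_l) : 2 * throughput <=
    prob (parity_differ (s + i) (s + j)) + 2 * E + 2 * (i == j)%:R.
  have [->|ij] := eqVneq i j.
    have := prob_ge0 (parity_differ (s + j) (s + j)).
    have sN : (s < N)%N by lia.
    by rewrite -(flux sN) mulr1; have := prob_le1 (served s); lra.
  rewrite mulr0 addr0; case: (ltngtP i j) => [ij'|ji|/val_inj ijE].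
  - exact: sub.
  - rewrite (_ : prob _ = prob (parity_differ (s + j) (s + i))); first exact: sub.
    by apply: eq_bigl => x; rewrite /parity_differ eq_sym.
  - by rewrite ijE eqxx in ij.
have sum_pairs : \sum_(i < l) \sum_(j < l) (2 * throughput) <=
    \sum_(i < l) \sum_(j < l)
      (prob (parity_differ (s + i) (s + j)) + 2 * E + 2 * (i == j)%:R).
  by apply: ler_sum => i _; apply: ler_sum => j _; apply: pair.
have parity : \sum_(i < l) \sum_(j < l) prob (parity_differ (s + i) (s + j))
    <= l%:R ^+ 2 / 2.
  have -> : \sum_(i < l) \sum_(j < l) prob (parity_differ (s + i) (s + j)) =
      mean (fun x => \sum_(i < l) \sum_(j < l) (parity_differ (s + i) (s + j) x)%:R).
    rewrite mean_sum; apply: eq_bigr => i _; rewrite mean_sum.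
    by apply: eq_bigr => j _; rewrite mean_ind.
  rewrite -[leRHS]mean_cst; apply: mean_le => x.
  by have := @parity_pairs 'I_l (fun i => odd (queue x (s + i))); rewrite card_ord.
have diag : \sum_(i < l) \sum_(j < l) 2 * (i == j)%:R = 2 * l%:R :> R.
  under eq_bigr => i _.
    rewrite (bigD1 i) //= eqxx mulr1 big1 ?addr0 => [|j]; first over.
    by rewrite eq_sym => /negbTE ->; rewrite mulr0.
  by rewrite sumr_const card_ord mulr_natr.
have cst (a : R) : \sum_(i < l) \sum_(j < l) a = l%:R ^+ 2 * a.
  by rewrite !sumr_const card_ord -[LHS]mulr_natl -[a *+ l]mulr_natl mulrA expr2.
move: sum_pairs; under [leRHS]eq_bigr do rewrite !big_split /=.
rewrite !big_split /= diag !cst => sum_pairs.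
rewrite -(ler_pM2l (exprn_gt0 2 lr0)) !mulrDr.
have -> : l%:R ^+ 2 * l%:R^-1 = l%:R :> R by field; rewrite gt_eqF.
lra.
Qed.

(** Summing over B consecutive blocks leaves the total roughness, which [roughness_bound] controls;
    single blocks may be rough. *)
Lemma throughput_average B l : (0 < l)%N -> L = (B * l)%N ->
  B%:R * throughput <= B%:R * (4^-1 + l%:R^-1) + \sum_(b < L) roughness b.
Proof.
move=> l0 LE; rewrite -(big_mkord xpredT roughness) LE.
have : (B * l <= L)%N by rewrite LE.
elim: B {LE} => [|B IH] BL; first by rewrite !mul0r big_geq // addr0.
have BL' : (B * l <= L)%N by rewrite (leq_trans _ BL) // leq_mul2r leqnSn orbT.
rewrite (@big_cat_nat _ _ _ (B * l)) //=; last by rewrite leq_mul2r leqnSn orbT.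
have := IH BL'; have := @throughput_block (B * l) l l0.
have -> : (B * l + l = B.+1 * l)%N by rewrite mulSn addnC.
rewrite (leq_trans BL) // => /(_ isT).
rewrite -natr1; lra.
Qed.

End stationary_tandem.

(** * Saturation of the first site *)

Section small_constants.
Variable R : realType.

Lemma exists_nat_ge (x : R) : exists n : nat, x <= n%:R.
Proof.
by exists (Num.bound `|x|); rewrite (le_trans (ler_norm x)) // ltW // archi_boundP.
Qed.

Lemma exists_inv_le (e : R) : 0 < e -> exists2 n : nat, (0 < n)%N & n%:R^-1 <= e.
Proof.
move=> e0; have [n en] := exists_nat_ge e^-1; exists n.
  by rewrite -(ltr0n R) (lt_le_trans _ en) // invr_gt0.
by rewrite -[e]invrK lef_pV2 // posrE ?invr_gt0 // (lt_le_trans _ en) // invr_gt0.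
Qed.

Lemma exists_expRN_le (e : R) : 0 < e -> exists2 M : R, 0 <= M & expR (- M) <= e.
Proof.
move=> e0; exists e^-1; first by rewrite invr_ge0 ltW.
rewrite expRN -[leRHS]invrK lef_pV2 ?posrE ?expR_gt0 ?invr_gt0 //.
by rewrite (le_trans _ (expR_ge1Dx _)) // lerDr.
Qed.

End small_constants.

(** With e half the gap lambda - 1/4, the throughput of a suitable long tandem is at most 1/4 + e,
    and it equals lambda times the probability that the first queue is below K. *)
Lemma saturation (R : realType) (lam : R) K N0 : 4^-1 < lam ->
  exists2 L, (N0 <= L)%N & forall p : config L.+1 K -> R,
    stationary (rate lam (N := L.+1)) (@move L.+1 K) p ->
    (1 - (4 * lam)^-1) / 2 <= prob p (fun x => K <= queue x 0)%N.
Proof.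
move=> lam4; have lam0 : 0 < lam by rewrite (lt_trans _ lam4) // invr_gt0.
pose e := (lam - 4^-1) / 2; have e0 : 0 < e by rewrite divr_gt0 // subr_gt0.
have e20 : 0 < e / 2 by rewrite divr_gt0.
have [l l0 le] := exists_inv_le e20; have lr0 : 0 < l%:R :> R by rewrite ltr0n.
(* The parameters are fixed in the order l, y, M, B. Multiplied by y / 2, the target B e / 2 for the
   roughness splits into B e y / 8 for the constant [K0] and B e y / 16 for each of the two terms
   growing with the number of bonds. *)
pose y := Num.min 1 (e / 8 / l%:R).
have y0 : 0 < y by rewrite lt_min ltr01 /=; do 2?apply: divr_gt0.
have y1 : y <= 1 by rewrite ge_min lexx.
have yl : y * l%:R <= e / 8 by rewrite -ler_pdivlMr // ge_min lexx orbT.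
have [|M M0 Me] := @exists_expRN_le R (e / 16 * y / l%:R).
  by do 2?[apply: divr_gt0 | apply: mulr_gt0] => //; apply: divr_gt0.
pose K0 := lam + 1 + K%:R + lam * K.+1%:R * (M + 3).
have [B1 HB1] := exists_nat_ge (8 * K0 / (e * y)).
pose B := maxn B1 (maxn N0 1).
have B0 : 0 < B%:R :> R by rewrite ltr0n /B !leq_max !orbT.
exists (B * l)%N.
  by rewrite (leq_trans _ (leq_pmulr _ l0)) // /B !leq_max leqnn !orbT.
move=> p pst.
have HB : 8 * K0 <= B%:R * (e * y).
  have ey0 : 0 < e * y by apply: mulr_gt0.
  by rewrite -(ler_pdivrMr _ _ ey0) (le_trans HB1) // ler_nat leq_max leqnn.
have := throughput_average lam0 pst l0 erefl.
have y01 : 0 <= y <= 1 by rewrite ltW.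
have := roughness_bound lam0 pst y01 M0; rewrite -/K0.
set S := \sum_(b < _) _; set J := throughput _ _ => HS HJ.
have {}Me : expR (- M) * l%:R <= e / 16 * y by rewrite -ler_pdivlMr.
have HSB : S <= B%:R * (e / 2).
  rewrite -(ler_pM2l (_ : 0 < y / 2)) ?divr_gt0 // (le_trans HS) //.
  rewrite natrM.
  have h1 : B%:R * (expR (- M) * l%:R) <= B%:R * (e / 16 * y) by rewrite ler_pM2l.
  have h2 : B%:R * y * (y * l%:R) <= B%:R * y * (e / 8) by rewrite ler_pM2l // mulr_gt0.
  move: h1 h2 HB; set t1 := expR _; move: t1 => t1.
  clear; move: (B%:R : R) (l%:R : R) => b c h1 h2 h3.
  have -> : b * c * (t1 + y ^+ 2 / 2) = b * (t1 * c) + b * y * (y * c) / 2 by ring.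
  have -> : y / 2 * (b * (e / 2)) =
    b * (e * y) / 8 + b * (e / 16 * y) + b * y * (e / 8) / 2 by field.
  lra.
have HJ1 : J <= 4^-1 + e.
  rewrite -(ler_pM2l B0) (le_trans HJ) //.
  have : B%:R * l%:R^-1 <= B%:R * (e / 2) by rewrite ler_pM2l.
  rewrite !mulrDr; lra.
have tot : prob p (fun x => queue x 0 < K)%N + prob p (fun x => K <= queue x 0)%N = 1.
  rewrite -(p_sum1 pst) /prob [RHS](bigID (fun x => queue x 0 < K)%N) /=.
  by congr (_ + _); apply: eq_bigl => x; rewrite leqNgt.
have : prob p (fun x => queue x 0 < K)%N <= (4^-1 + e) / lam.
  by rewrite ler_pdivlMr // mulrC.
have -> : (4^-1 + e) / lam = 2^-1 + (4 * lam)^-1 / 2.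
  by rewrite /e; field; rewrite gt_eqF.
lra.
Qed.

(** * Monotonicity and minimal stationary law of the tandem *)

Section tandem_order.
Variables (R : realType) (lam : R) (L K : nat).
Hypothesis lam_gt0 : 0 < lam.
Local Notation N := L.+1.

Lemma move_mono c (x y : config N K) :
  le_config x y -> le_config (move c x) (move c y).
Proof.
move=> /le_configP xy; apply/le_configP => i iN; case: c => [n|].
  have := @move_serve_dom _ _ _ _ 0 x y n n i; rewrite !addn0; apply => // j jN.
  by rewrite addn0 xy.
exact: move_arrive_dom.
Qed.

Lemma rate_ge0 c : 0 <= rate lam (N := N) c.
Proof. by case: c => [?|] /=; rewrite ?ler01 // ltW. Qed.

(** The probability that the jump chain started empty has at least k customers at site n after m
    jumps. A lower bound on it involves finitely many events, so it carries over to other tandems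
    and to the Poisson clocks. *)
Definition reach n k m : R :=
  iter m (kernel (rate lam (N := N)) (@move N K))
    (fun x => (k <= queue x n)%N%:R) (empty N K).

Lemma queue_ge_increasing n k :
  increasing (@le_config N K) (fun x => (k <= queue x n)%N%:R : R).
Proof.
move=> x y /le_configP xy; rewrite ler_nat; case: (leqP k) => // kx.
rewrite lt0b (leq_trans kx) //; case: (ltnP n N) => [/xy//|nN].
by rewrite !queue_out.
Qed.

Lemma nat_bool01 (b : bool) : 0 <= (b%:R : R) <= 1.
Proof. by case: b; rewrite ?lexx ?ler01. Qed.

Lemma reach_bound n k m : 0 <= reach n k m <= 1.
Proof.
apply: iter_kernel_bound => [c||x]; rewrite ?rate_ge0 ?rate_sum_gt0 //.
exact: nat_bool01.
Qed.

Lemma tandem_stationary : exists2 p : config N K -> R,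
  stationary (rate lam (N := N)) (@move N K) p &
  forall n k eps, 0 < eps ->
    exists m, prob p (fun x => k <= queue x n)%N - eps <= reach n k m.
Proof.
have [|||||||p [pst lim]] := @stationary_limit R _ _ (rate lam (N := N)) (@move N K)
  (@le_config N K) (empty N K).
- exact: le_config_refl.
- exact: le_config_trans.
- exact: le_config_anti.
- exact: le_config_bot.
- exact: rate_ge0.
- exact: rate_sum_gt0.
- exact: move_mono.
exists p => // n k eps eps0.
have [m] := lim (fun x => (k <= queue x n)%N%:R) _ eps0.
rewrite -/(mean _ _) mean_ind ler_distlC => /andP[+ _]; by exists m.
Qed.

Lemma reach_le_prob (p : config N K -> R) n k m :
  stationary (rate lam (N := N)) (@move N K) p ->
  reach n k m <= prob p (fun x => k <= queue x n)%N.
Proof.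
move=> pst; rewrite -mean_ind.
apply: (stationary_ge (@le_config_bot N K) rate_ge0 (rate_sum_gt0 _ lam_gt0) move_mono) => //.
exact: queue_ge_increasing.
Qed.

End tandem_order.

(** * Slowly varying weights *)

Section ramp.
Variables (R : realType) (N K : nat).

(* A slowly varying version of the indicator of [b <= queue x 0]. *)
Definition ramp a b (x : config N K) : R :=
  (minn (queue x 0 - a) (b - a))%:R / (b - a)%:R.

Lemma ramp01 a b x : (a < b)%N -> 0 <= ramp a b x <= 1.
Proof.
move=> ab; rewrite /ramp divr_ge0 ?ler0n //= ler_pdivrMr ?ltr0n ?subn_gt0 //.
by rewrite mul1r ler_nat geq_minr.
Qed.

Lemma ramp_eq0 a b x : (queue x 0 <= a)%N -> ramp a b x = 0.
Proof. by rewrite /ramp -subn_eq0 => /eqP ->; rewrite min0n mul0r. Qed.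

Lemma ramp_ge a b x : (a < b)%N -> (b <= queue x 0)%N%:R <= ramp a b x.
Proof.
move=> ab; case: leqP => bx; last by case/andP: (ramp01 x ab).
rewrite /ramp (minn_idPr _) ?leq_sub2r // divff // pnatr_eq0; lia.
Qed.

Lemma ramp_mono a b x y : (queue x 0 <= queue y 0)%N -> ramp a b x <= ramp a b y.
Proof.
move=> xy; rewrite ler_wpM2r ?invr_ge0 ?ler0n // ler_nat leq_min geq_minr andbT.
by rewrite (leq_trans (geq_minl _ _)) // leq_sub2r.
Qed.

Lemma ramp_lipschitz a b x y : (queue y 0 <= (queue x 0).+1)%N ->
  ramp a b y - ramp a b x <= (b - a)%:R^-1.
Proof.
move=> xy; rewrite /ramp -mulrBl -[leRHS]mul1r ler_wpM2r ?invr_ge0 ?ler0n //.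
rewrite lerBlDr nat1r ler_nat; lia.
Qed.

Lemma ramp_arrive a b x : 0 <= ramp a b (move None x) - ramp a b x <= (b - a)%:R^-1.
Proof.
have := queue_move_arrive x 0; have := queue_le x 0.
case: (posnP N) => [N0|N0] /= qK; rewrite /= ?andbF => E.
  rewrite subr_ge0 ramp_mono ?ramp_lipschitz // ?E //; lia.
by rewrite subr_ge0 ramp_mono ?ramp_lipschitz // E; lia.
Qed.

Lemma ramp_serve a b (n : 'I_N) x :
  0 <= ramp a b x - ramp a b (move (Some n) x) <=
    if n == 0 :> nat then (b - a)%:R^-1 else 0.
Proof.
have := queue_move_serve x n 0; rewrite (eq_sym 0%N) andFb.
case: eqVneq => [n0|n0] E; last first.
  by rewrite if_same in E; rewrite /ramp E subrr lexx.
rewrite subr_ge0 ramp_mono ?ramp_lipschitz // E -?n0; case: ifP => // _.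
  exact: leqSpred.
exact: leq_pred.
Qed.

End ramp.

(** * Saturation with probability tending to one *)

Section bootstrap.
Variables (R : realType).

(** The window of N sites starting at s, clipped at K, through which a large tandem is compared with
    a smaller one. *)
Definition project N K N' K' s (x : config N' K') : config N K :=
  config_of N K (fun i => queue x (i + s)).

Lemma queue_project N K N' K' s (x : config N' K') i :
  queue (project N K s x) i = if (i < N)%N then minn (queue x (i + s)) K else 0%N.
Proof. exact: queue_config_of. Qed.

Lemma le_project N K N' K' s (y : config N K) (x : config N' K') :
  (forall i, (i < N)%N -> (queue y i <= queue x (i + s))%N) ->
  le_config y (project N K s x).
Proof.
move=> yx; apply/le_configP => i iN; rewrite queue_project iN leq_min yx //.
exact: queue_le.
Qed.

Lemma project_move_serve N K N' K' s (x : config N' K') (n : 'I_N) (m : 'I_N') :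
  m = (n + s)%N :> nat -> (N + s <= N')%N ->
  le_config (move (Some n) (project N K s x)) (project N K s (move (Some m) x)).
Proof.
move=> mn NN'; apply: le_project => i iN; apply: move_serve_dom => //; first by lia.
by move=> j jN; rewrite queue_project jN geq_minl.
Qed.

Lemma project_move_serve_out N K N' K' s (x : config N' K') (m : 'I_N') :
  (N + s <= m)%N -> project N K s (move (Some m) x) = project N K s x.
Proof.
move=> Nm; apply: queue_eqP => i iN; rewrite !queue_project iN queue_move_serve.
have -> : (i + s == m)%N = false by lia.
have -> : (i + s == m.+1)%N = false by lia.
by rewrite if_same.
Qed.

Section generators.
Variables (N K N' K' : nat) (F : config N K -> R).
Hypotheses (Fi : increasing (@le_config N K) F).

(** Each event moves the small tandem no higher than the window of the large one, and services
    beyond the window leave it fixed. *)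
Lemma gen_project0 (lam : R) (x : config N' K') :
  0 <= lam -> (N <= N')%N -> (K <= K')%N -> (0 < N')%N ->
  gen (rate lam (N := N)) (@move N K) F (project N K 0 x) <=
  gen (rate lam (N := N')) (@move N' K') (fun x => F (project N K 0 x)) x.
Proof.
move=> lam0 NN' KK' N'0; rewrite !genE; apply: lerD.
  rewrite ler_wpM2l // lerD2r; apply: Fi; apply: le_project => i iN; rewrite addn0.
  apply: move_arrive_dom => //; first by lia.
  by move=> j jN; rewrite queue_project jN addn0 geq_minl.
pose G n := F (config_of N K (serve n (queue (project N K 0 x)))) - F (project N K 0 x).
pose G' n := F (project N K 0 (config_of N' K' (serve n (queue x)))) - F (project N K 0 x).
rewrite -/(\sum_(n < N) G n) -/(\sum_(n < N') G' n).
rewrite [leRHS](bigID (fun n : 'I_N' => (n < N)%N)) /= [X in _ + X]big1 ?addr0; last first.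
  move=> n; rewrite -leqNgt => Nn.
  by rewrite /G' -/(move (Some n) x) project_move_serve_out ?subrr // addn0.
rewrite (big_ord_widen N' G NN'); apply: ler_sum => n nN.
rewrite lerD2r; apply: Fi.
have := @project_move_serve N K N' K' 0 x (Ordinal nN) n.
by rewrite !addn0; apply.
Qed.

(** While the first site holds more than K customers, its service feeds the window at rate 1
    whenever there is room, as arrivals would; the real arrivals do not touch the window. *)
Lemma gen_project1 (lam : R) (x : config N' K') :
  (N < N')%N -> (K < queue x 0)%N ->
  gen (rate 1 (N := N)) (@move N K) F (project N K 1 x) <=
  gen (rate lam (N := N')) (@move N' K') (fun x => F (project N K 1 x)) x.
Proof.
case: N' x => // M x NM Kx; rewrite !genE.
have -> : project N K 1 (move None x) = project N K 1 x.
  apply: queue_eqP => i iN; rewrite !queue_project iN queue_move_arrive.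
  by rewrite addn1.
rewrite subrr mulr0 add0r mul1r big_ord_recl; apply: lerD.
  rewrite lerD2r; apply: Fi; apply: le_project => i iN; rewrite addn1.
  apply: move_arrive_dom_shift => // [|j jN]; first by lia.
  by rewrite queue_project jN addn1 geq_minl.
pose G n := F (config_of N K (serve n (queue (project N K 1 x)))) - F (project N K 1 x).
pose G' n := F (project N K 1 (config_of M.+1 K' (serve n.+1 (queue x)))) - F (project N K 1 x).
rewrite -/(\sum_(n < N) G n) -/(\sum_(n < M) G' n).
rewrite [leRHS](bigID (fun n : 'I_M => (n < N)%N)) /= [X in _ + X]big1 ?addr0; last first.
  move=> n; rewrite -leqNgt => Nn.
  rewrite /G' -/(move (Some (lift ord0 n)) x) project_move_serve_out ?subrr //.
  by rewrite addn1 lift0.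
rewrite (big_ord_widen M G NM); apply: ler_sum => n nN.
rewrite lerD2r; apply: Fi.
have := @project_move_serve N K M.+1 K' 1 x (Ordinal nN) (lift ord0 n).
by rewrite !addn1; apply.
Qed.

End generators.


(** The law weighted by [w] fits [supersolution_ge] for the small tandem. Generators have to be
    compared only where [w] is positive; [stationary_product] leaves an error at most [d], with [h]
    standing for the values of the test function after a move. *)
Lemma weighted_domination (lam1 lam : R) L K L' K' (p w : config L'.+1 K' -> R)
    s (d : R) n k m :
  0 < lam1 -> 0 < lam ->
  stationary (rate lam (N := L'.+1)) (@move L'.+1 K') p ->
  (forall x, 0 <= w x) ->
  (forall F, increasing (@le_config L.+1 K) F -> forall x,
    w x * gen (rate lam1 (N := L.+1)) (@move L.+1 K) F (project L.+1 K s x) <=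
    w x * gen (rate lam (N := L'.+1)) (@move L'.+1 K')
      (fun x => F (project L.+1 K s x)) x) ->
  (forall x (h : option 'I_L'.+1 -> R), (forall c, 0 <= h c <= 1) ->
    \sum_c rate lam c * ((w x - w (move c x)) * h c) <= d) ->
  mean p w * reach lam1 L K n k m <=
  mean p (fun x => w x * (k <= queue (project L.+1 K s x) n)%N%:R)
    + m%:R * (d / rate_sum (rate lam1 (N := L.+1))).
Proof.
move=> lam10 lam0 pst w0 wgen wd; have [p0 p1 _] := pst.
rewrite [X in _ <= X + _](_ : _ = \sum_x (p x * w x) *
    (k <= queue (project L.+1 K s x) n)%N%:R); last first.
  by apply: eq_bigr => x _; rewrite mulrA.
apply: (supersolution_ge (le := @le_config L.+1 K)
  (@le_config_bot L.+1 K) (rate_ge0 lam10) (rate_sum_gt0 L lam10) (@move_mono L K)).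
- by move=> x; apply: mulr_ge0; [apply: p_ge0 pst x | apply: w0].
- move=> F Fi F01.
  apply: (@le_trans _ _ (\sum_x (p x * w x) * gen (rate lam (N := L'.+1)) (@move L'.+1 K')
      (fun x => F (project L.+1 K s x)) x)).
    by apply: ler_sum => x _; rewrite -!mulrA ler_wpM2l // wgen.
  rewrite (stationary_product _ _ pst) -[leRHS](mean_cst pst).
  by apply: (mean_le pst) => x; apply: wd.
- exact: queue_ge_increasing.
- by move=> y; apply: nat_bool01.
Qed.

(** Let g be the ramp from k to K', with mean at least delta by [saturation] at K'. The law weighted
    by 1 - g is almost stationary, so it dominates the small tandem with mass 1 - mean g. Since g
    lives on queues longer than k, both contributions count towards length at least k. *)
Lemma bootstrap_step (lam : R) k L K m N0 (eps : R) : 4^-1 < lam -> 0 < eps ->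
  let delta := (1 - (4 * lam)^-1) / 2 in
  exists L' K' m', (N0 <= L')%N /\
    delta + (1 - delta) * reach lam L K 0 k m - eps <= reach lam L' K' 0 k m'.
Proof.
move=> lam4 eps0 delta.
have lam0 : 0 < lam by rewrite (lt_trans _ lam4) // invr_gt0.
have rs0 := rate_sum_gt0 L lam0.
pose D := m%:R * (lam / rate_sum (rate lam (N := L.+1))).
(* [w] is the width of the ramp: with slope below 1 / w, the m jumps of the comparison cost at most
   eps / 2. *)
have [w Hw] := exists_nat_ge (2 * D / eps).
pose K' := (maxn k K + w.+1)%N.
have kK' : (k < K')%N by rewrite /K' addnS ltnS (leq_trans (leq_maxl _ K)) ?leq_addr.
have KK' : (K <= K')%N by rewrite (leq_trans (leq_maxr k _)) ?leq_addr.
have wK' : (w.+1 <= K' - k)%N.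
  by rewrite leq_subRL ?(ltnW kK') // leq_add2r leq_maxl.
have [L' + sat] := saturation K' (maxn N0 L) lam4.
rewrite geq_max => /andP[N0L' LL'].
have [p pst lim] := tandem_stationary L' K' lam0.
pose g : config L'.+1 K' -> R := ramp R k K'.
have g01 x : 0 <= g x <= 1 by apply: ramp01.
pose F (x : config L'.+1 K') : R := (k <= queue (project L.+1 K 0 x) 0)%N%:R.
have dom : mean p (fun x => 1 - g x) * reach lam L K 0 k m <=
    mean p (fun x => (1 - g x) * F x)
    + m%:R * (lam * (K' - k)%:R^-1 / rate_sum (rate lam (N := L.+1))).
  apply: (@weighted_domination lam lam L K L' K' p (fun x => 1 - g x) 0 _ 0 k m
    lam0 lam0 pst) => [x|G Gi x|x h h01].
  - by case/andP: (g01 x) => _; rewrite subr_ge0.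
  - by case/andP: (g01 x) => _ g1; rewrite ler_wpM2l ?subr_ge0 // gen_project0 // ltW.
  (* Only arrivals raise g, by at most the slope; services lower it and so contribute nothing
     positive. *)
  - rewrite sum_option /= -[leRHS]addr0; apply: lerD.
      rewrite ler_wpM2l ?(ltW lam0) //.
      have -> : 1 - g x - (1 - g (move None x)) = g (move None x) - g x by ring.
      have /andP[r0 r1] := ramp_arrive R k K' x.
      have /andP[h0 h1] := h01 None.
      by rewrite (le_trans _ r1) // ler_piMr.
    apply: sumr_le0 => n _; rewrite mul1r.
    have -> : 1 - g x - (1 - g (move (Some n) x)) = g (move (Some n) x) - g x by ring.
    have /andP[r0 _] := ramp_serve R k K' n x; have /andP[h0 _] := h01 (Some n).
    by rewrite mulr_le0_ge0 // -oppr_ge0 opprB.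
have [m' Hm'] := lim 0%N k (eps / 2) (divr_gt0 eps0 (ltr0Sn _ _)).
exists L', K', m'; split => //; apply: le_trans Hm'.
have HD : m%:R * (lam * (K' - k)%:R^-1 / rate_sum (rate lam (N := L.+1))) <= eps / 2.
  have k0 : 0 < (K' - k)%:R :> R by rewrite ltr0n (leq_trans _ wK').
  have -> : m%:R * (lam * (K' - k)%:R^-1 / rate_sum (rate lam (N := L.+1)))
    = D / (K' - k)%:R by rewrite /D; field; rewrite !gt_eqF.
  rewrite ler_pdivrMr // -ler_pdivrMl ?divr_gt0 //.
  rewrite (_ : (eps / 2)^-1 * D = 2 * D / eps); last by field; rewrite gt_eqF.
  by rewrite (le_trans Hw) // ler_nat ltnW.
have Hg : delta <= mean p g.
  rewrite (le_trans (sat p pst)) // -mean_ind; apply: (mean_le pst) => x.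
  exact: ramp_ge.
have HF : mean p g + mean p (fun x => (1 - g x) * F x)
    <= prob p (fun x => k <= queue x 0)%N.
  rewrite -meanD -mean_ind; apply: (mean_le pst) => x.
  rewrite /F queue_project /= addn0; have /andP[g0 g1] := g01 x.
  case: (leqP k (queue x 0)) => kx.
    rewrite -lerBrDl -[leRHS]mulr1 ler_wpM2l ?subr_ge0 //.
    by case: (_ <= _)%N; rewrite ?ler01.
  have -> : (k <= minn (queue x 0) K)%N = false by rewrite leq_min leqNgt kx.
  by rewrite mulr0 addr0 /g ramp_eq0 // ltnW.
have HB : mean p (fun x => 1 - g x) = 1 - mean p g by rewrite meanB (mean_cst pst).
have /andP[u0 u1] := reach_bound L K lam0 0 k m.
move: dom HD HF; rewrite HB; set u := reach _ _ _ _ _ _ in u0 u1 *.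
have : 0 <= (mean p g - delta) * (1 - u) by rewrite mulr_ge0 // subr_ge0.
move: (mean p g) (mean p _) (prob p _) (m%:R * _) => a b c e.
rewrite -/u; move: u u0 u1 delta Hg => u _ _ dl _; clear.
lra.
Qed.

(** The supremum v of the attainable values satisfies v >= delta + (1 - delta) v by
    [bootstrap_step], hence v = 1. The bound [N0] makes the tandem long enough to contain a shifted
    window. *)
Lemma first_site_saturates (lam : R) k N0 (eps : R) : 4^-1 < lam -> 0 < eps ->
  exists L K m, (N0 <= L)%N /\ 1 - eps <= reach lam L K 0 k m.
Proof.
move=> lam4 eps0.
have lam0 : 0 < lam by rewrite (lt_trans _ lam4) // invr_gt0.
pose delta := (1 - (4 * lam)^-1) / 2.
have d0 : 0 < delta.
  rewrite divr_gt0 // subr_gt0 invf_lt1 ?mulr_gt0 //.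
  by rewrite -ltr_pdivrMl // mulr1.
pose E : set R := [set u | exists L K m, (N0 <= L)%N /\ u = reach lam L K 0 k m].
have Eub : ubound E 1.
  by move=> _ [L [K [m [_ ->]]]]; case/andP: (reach_bound L K lam0 0 k m).
have Esup : has_sup E.
  split; last by exists 1.
  by exists (reach lam N0 0 0 k 0), N0, 0%N, 0%N.
have step (e : R) : 0 < e -> delta * (1 - sup E) <= 2 * e.
  move=> e0; have [_ [L [K [m [NL ->]]]] Hu] := sup_adherent e0 Esup.
  have [L' [K' [m' [NL' Hu']]]] := bootstrap_step k L K m N0 lam4 e0.
  have /(ub_le_sup Esup.2) : E (reach lam L' K' 0 k m') by exists L', K', m'.
  rewrite -/delta in Hu'.
  have d1 : delta <= 1.
    have : 0 <= (4 * lam)^-1 by rewrite invr_ge0 mulr_ge0 // ltW.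
    by rewrite /delta; lra.
  have : 0 <= (1 - delta) * (reach lam L K 0 k m - (sup E - e)).
    by rewrite mulr_ge0 // subr_ge0 // ltW.
  have : 0 <= delta * e by rewrite mulr_ge0 // ltW.
  move: Hu'; move: (reach _ _ _ _ _ _) (reach _ _ _ _ _ _) (sup E) => u v t.
  lra.
have sup1 : 1 <= sup E.
  rewrite -subr_le0 -(pmulr_rle0 _ d0) -[leLHS]mulr1 leNgt; apply/negP => H.
  rewrite mulr1 in H.
  have := step (delta * (1 - sup E) / 4) (divr_gt0 H (ltr0Sn _ _)).
  lra.
have [_ [L [K [m [NL ->]]]] Hu] := sup_adherent eps0 Esup.
by exists L, K, m; split => //; rewrite (le_trans _ (ltW Hu)) // lerD2r.
Qed.

(** Induction on the site. Weighted by a ramp that vanishes unless the first queue exceeds K, the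
    sites behind it dominate a tandem fed at rate 1, to which the induction hypothesis applies
    because 1 > 1/4. *)
Lemma every_site_saturates n (lam : R) k (eps : R) : 4^-1 < lam -> 0 < eps ->
  exists L K m, 1 - eps <= reach lam L K n k m.
Proof.
elim: n lam eps => [|n IH] lam eps lam4 eps0.
  by have [L [K [m [_ H]]]] := first_site_saturates k 0 lam4 eps0; exists L, K, m.
have lam0 : 0 < lam by rewrite (lt_trans _ lam4) // invr_gt0.
(* One quarter each for the induction hypothesis, the mean of the ramp, the defect of stationarity
   and the passage to finitely many jumps. *)
pose e := eps / 4; have e0 : 0 < e by rewrite divr_gt0.
have [|//|L [K [m Hr]]] := IH 1 e; first by rewrite invf_lt1 // ltr1n.
have rs0 := rate_sum_gt0 L (ltr01 : 0 < 1 :> R).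
pose D : R := m%:R * (1 / rate_sum (rate 1 (N := L.+1))).
have [w Hw] := exists_nat_ge (D / e).
pose H := (K + w.+1)%N.
have KH : (K < H)%N by rewrite /H addnS ltnS leq_addr.
have [L' [K' [m' [LL' Hr']]]] := first_site_saturates H L.+1 lam4 e0.
have [p pst lim] := tandem_stationary L' K' lam0.
have {}Hr' := le_trans Hr' (reach_le_prob lam0 0 H m' pst).
pose g : config L'.+1 K' -> R := ramp R K H.
have g01 x : 0 <= g x <= 1 by apply: ramp01.
pose F (x : config L'.+1 K') : R := (k <= queue (project L.+1 K 1 x) n)%N%:R.
have dom : mean p g * reach 1 L K n k m <= mean p (fun x => g x * F x)
    + m%:R * ((H - K)%:R^-1 / rate_sum (rate 1 (N := L.+1))).
  apply: (@weighted_domination 1 lam L K L' K' p g 1 _ n k m ltr01 lam0 pst) => [x|G Gi x|x h h01].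
  - by case/andP: (g01 x).
  - case: (leqP (queue x 0) K) => Kx; first by rewrite /g ramp_eq0 // !mul0r.
    by case/andP: (g01 x) => g0 _; rewrite ler_wpM2l // gen_project1 // ltnS.
  - rewrite sum_option /= -[leRHS]add0r; apply: lerD.
      have /andP[r0 _] := ramp_arrive R K H x; have /andP[h0 _] := h01 None.
      rewrite mulr_ge0_le0 ?(ltW lam0) // mulr_le0_ge0 //.
      by rewrite -oppr_ge0 opprB.
    rewrite big_ord_recl /= big1 => [|i _].
      have /andP[r0 r1] := ramp_serve R K H ord0 x.
      have /andP[h0 h1] := h01 (Some ord0).
      by rewrite mul1r addr0 (le_trans _ r1) // ler_piMr.
    have /andP[r0 r1] := ramp_serve R K H (lift ord0 i) x.
    have -> : g x - g (move (Some (lift ord0 i)) x) = 0 by apply/le_anti; rewrite r0 r1.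
    by rewrite mul0r mulr0.
have [m'' Hm] := lim n.+1 k e e0.
exists L', K', m''; apply: le_trans Hm.
have HD : m%:R * ((H - K)%:R^-1 / rate_sum (rate 1 (N := L.+1))) <= e.
  have -> : (H - K = w.+1)%N by rewrite /H addKn.
  have k0 : 0 < w.+1%:R :> R by rewrite ltr0n.
  have -> : m%:R * (w.+1%:R^-1 / rate_sum (rate 1 (N := L.+1))) = D / w.+1%:R.
    by rewrite /D; field; rewrite !gt_eqF.
  rewrite ler_pdivrMr // -ler_pdivrMl // mulrC (le_trans Hw) // ler_nat //.
have Hg : 1 - e <= mean p g.
  rewrite (le_trans Hr') // -mean_ind; apply: (mean_le pst) => x.
  exact: ramp_ge.
have HF : mean p (fun x => g x * F x) <= prob p (fun x => k <= queue x n.+1)%N.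
  rewrite -mean_ind; apply: (mean_le pst) => x.
  rewrite /F queue_project addn1; have /andP[g0 g1] := g01 x.
  have [kx|kx] := leqP k (queue x n.+1).
    by rewrite mulr_ile1 ?ler0n //; case: (_ <= _)%N; rewrite ?ler01.
  rewrite (_ : (k <= _)%N = false) ?mulr0 //.
  apply/negbTE; rewrite -ltnNge; case: ifP => _; last by rewrite (leq_trans _ kx).
  by rewrite gtn_min kx.
have /andP[u0 u1] := reach_bound L K (ltr01 : 0 < 1 :> R) n k m.
have : 0 <= (mean p g - (1 - e)) * reach 1 L K n k m by rewrite mulr_ge0 // subr_ge0.
have : 0 <= e * (1 - reach 1 L K n k m) by rewrite mulr_ge0 ?subr_ge0 // ltW.
have -> : eps = 4 * e by rewrite /e; field.
move: dom HD HF Hr; move: (reach _ _ _ _ _ _) => u.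
move: (mean p g) (mean p _) (prob p _) (m%:R * _) => a b c f.
clear; lra.
Qed.

End bootstrap.

(** * Comparison of paths *)

Section extended_queue_lengths.
Variable R : realType.

Lemma exp_neg_Some_le (i j : nat) :
  (exp_neg R (Some i) <= exp_neg R (Some j)) = (j <= i)%N.
Proof. by rewrite ler_expR lerN2 ler_nat. Qed.

Lemma exp_neg_ge0 x : 0 <= exp_neg R x.
Proof. by case: x => [i|] //=; apply: expR_ge0. Qed.

Lemma exp_neg_inj : injective (@exp_neg R).
Proof.
case=> [i|] [j|] //= E.
- have := exp_neg_Some_le i j; have := exp_neg_Some_le j i.
  rewrite /= E lexx => /esym ij /esym ji; congr Some; apply/eqP.
  by rewrite eqn_leq ij ji.
- by have := expR_gt0 (- i%:R : R); rewrite E ltxx.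
- by have := expR_gt0 (- j%:R : R); rewrite -E ltxx.
Qed.

(** The range of [exp_neg] has gaps: the next value below e^-j is e^-(j+1), and their midpoint is
    missed. By the intermediate value theorem a continuous path of queue lengths is then
    constant. *)
Lemma exp_neg_gap x y : exp_neg R x < exp_neg R y ->
  exists2 v, exp_neg R x < v < exp_neg R y & forall z, exp_neg R z <> v.
Proof.
case: y => [j|]; last by rewrite ltNge exp_neg_ge0.
move=> xy; pose e1 := exp_neg R (Some j.+1).
have e10 : 0 < e1 by apply: expR_gt0.
have e1j : e1 < exp_neg R (Some j) by rewrite ltNge exp_neg_Some_le ltnn.
have xe1 : exp_neg R x <= e1.
  case: x xy => [i|_]; last exact: ltW.
  by rewrite ltNge !exp_neg_Some_le -ltnNge.
exists ((e1 + exp_neg R (Some j)) / 2); first by apply/andP; split; lra.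
move=> z zv.
have /andP[h1 h2] : e1 < exp_neg R z < exp_neg R (Some j).
  by rewrite zv; apply/andP; split; lra.
case: z {zv} h1 h2 => [l|]; last by move=> h1 _; move: (lt_trans e10 h1); rewrite ltxx.
by rewrite !ltNge !exp_neg_Some_le -!ltnNge ltnS => h1 h2; move: (leq_trans h2 h1); rewrite ltnn.
Qed.

Lemma exp_neg_continuous_constant (f : R -> option nat) (a b : R) : a <= b ->
  {within `[a, b], continuous (fun u => exp_neg R (f u))} -> f a = f b.
Proof.
move=> ab fc; apply: exp_neg_inj; apply/eqP; rewrite eq_le !leNgt.
apply/andP; split; apply/negP => /exp_neg_gap[v /andP[v1 v2] nv];
  have [] := @IVT R (fun u => exp_neg R (f u)) a b v ab fc.
- by rewrite ge_min le_max /= (ltW v1) (ltW v2) ?orbT.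
- by move=> c _ /nv.
- by rewrite ge_min le_max /= (ltW v1) (ltW v2) ?orbT.
- by move=> c _ /nv.
Qed.

Lemma exp_neg_coord_continuous n : continuous (fun x : state R => exp_neg R (x n)).
Proof.
move=> x; apply: (@continuous_comp _ _ _ (fun y : state R => y n) (@exp_neg R : enat R -> R)).
  exact: (@proj_continuous nat (fun=> enat R) n x).
exact: initial_continuous.
Qed.

Lemma coord_cvg (q : R -> state R) (F : set_system R) (x : state R) n : Filter F ->
  q u @[u --> F] --> x -> exp_neg R (q u n) @[u --> F] --> exp_neg R (x n).
Proof. move=> FF qx.
exact: (cvg_comp _ (fun y : state R => exp_neg R (y n)) qx
  (@exp_neg_coord_continuous n x)).
 Qed.

End extended_queue_lengths.

Section path_constancy.
Variables (R : realType) (f : R -> option nat).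
Hypothesis f_right : forall t, 0 <= t -> exp_neg R (f u) @[u --> t^'+] --> exp_neg R (f t).

Lemma constant_on_closed (t1 t2 : R) : 0 <= t1 -> t1 <= t2 ->
  (forall tau, t1 < tau <= t2 -> exp_neg R (f u) @[u --> tau^'-] --> exp_neg R (f tau)) ->
  f t2 = f t1.
Proof.
move=> t10; rewrite le_eqVlt => /predU1P[->//|t12] fl.
apply/esym/exp_neg_continuous_constant; first exact: ltW.
apply/continuous_within_itvP => //; split.
- move=> tau; rewrite in_itv /= => /andP[t1t tt2].
  apply/left_right_continuousP; split; first by apply: fl; rewrite t1t ltW.
  by apply: f_right; rewrite ltW // (le_lt_trans t10).
- exact: f_right.
- by apply: fl; rewrite t12 lexx.
Qed.

Lemma left_limit_constant (t1 t2 : R) l : 0 <= t1 -> t1 < t2 ->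
  (forall tau, t1 < tau < t2 -> exp_neg R (f u) @[u --> tau^'-] --> exp_neg R (f tau)) ->
  exp_neg R (f u) @[u --> t2^'-] --> exp_neg R l -> l = f t1.
Proof.
move=> t10 t12 fl fcv; apply: (@exp_neg_inj R).
apply: (cvg_unique _ fcv) => //.
apply: cvg_near_cst; near=> u.
congr exp_neg; apply: constant_on_closed => //.
  by apply: ltW; near: u; apply: nbhs_left_gt.
by move=> tau /andP[t1t tu]; apply: fl; rewrite t1t (le_lt_trans tu).
Unshelve. all: by end_near. Qed.

End path_constancy.

(** The point is the infimum of the times at which the final value has been reached; by right
    continuity the value is attained there. An increment of one leaves no room for a second jump. *)
Lemma counting_jump (R : realType) (N : R -> nat) (t1 t2 : R) :
  0 <= t1 -> t1 <= t2 ->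
  (forall u v, 0 <= u -> u <= v -> (N u <= N v)%N) ->
  (forall t, 0 <= t -> N u @[u --> t^'+] --> N t) ->
  N t2 = (N t1).+1 ->
  exists tau, [/\ t1 < tau <= t2, point_of N tau
    & forall sg, t1 < sg <= t2 -> sg != tau -> ~ point_of N sg].
Proof.
move=> t10 t12 Nm Nr N2.
pose E := [set u | t1 <= u <= t2 /\ N u = N t2].
have E2 : E t2 by rewrite /E /= t12 lexx.
have Elb : lbound E t1 by move=> u [/andP[]].
have Einf : has_inf E by split; [exists t2|exists t1].
pose tau := inf E.
have t1tau : t1 <= tau by apply: lb_le_inf => //; exists t2.
have taut2 : tau <= t2 by apply: ge_inf => //; exists t1.
have tau0 : 0 <= tau by apply: le_trans t1tau.
have right_of u : tau < u -> u <= t2 -> N u = N t2.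
  move=> tu ut2; have u0 : 0 < u - tau by rewrite subr_gt0.
  have [v [/andP[t1v vt2] Nv]] := inf_adherent u0 Einf.
  rewrite -/tau addrC subrK => /ltW vu.
  apply/eqP; rewrite eqn_leq Nm ?(le_trans tau0 (ltW tu)) //= -Nv Nm //.
  exact: le_trans t1v.
have Ntau : N tau = N t2.
  have [->//|ne] := eqVneq tau t2.
  have tlt : tau < t2 by rewrite lt_neqAle ne.
  have H : \forall u \near tau^'+, N u = N tau.
    by have := Nr tau tau0 _ (discrete_set1 (N tau)); apply.
  have H' : \forall u \near tau^'+, N u = N t2.
    by near=> u; apply: right_of; near: u; [exact: nbhs_right_gt|exact: nbhs_right_le].
  have [u [<- ->//]] : exists u, N u = N tau /\ N u = N t2.
  by apply: (@filter_ex _ tau^'+); apply: filterI.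
have left_of u : t1 <= u -> u < tau -> N u = N t1.
  move=> t1u ut; have u0 := le_trans t10 t1u.
  have nE : N u <> N t2.
    move=> Nu; have : E u by rewrite /E /= t1u (le_trans (ltW ut) taut2).
    by move/(ge_inf Einf.2); rewrite -/tau leNgt ut.
  have := Nm _ _ t10 t1u; have := Nm _ _ u0 (le_trans (ltW ut) taut2).
  by move: nE; rewrite N2; clear; lia.
have t1tau' : t1 < tau.
  rewrite lt_neqAle t1tau andbT; apply/eqP => E1; move: N2; rewrite -Ntau -E1.
  by clear; lia.
exists tau; split; first by rewrite t1tau'.
- split; first exact: le_lt_trans t1tau'.
  move=> s /andP[s0 st]; rewrite Ntau N2 ltnS.
  have [t1s|/ltW st1] := leP t1 s; first by rewrite left_of.
  exact: Nm.
- move=> sg /andP[t1s st2] ne [_ jump].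
  have [st|ts|E1] := ltgtP sg tau.
  + by have := jump t1; rewrite t10 t1s left_of ?(ltW t1s) // ltnn => /(_ isT).
  + by have := jump tau; rewrite tau0 ts Ntau right_of // ltnn => /(_ isT).
  + by rewrite E1 eqxx in ne.
Unshelve. all: by end_near. Qed.

Section path_comparison.
Variables (R : realType) (N K : nat).
Implicit Types (x : config N K) (z : state R).

Definition le_queue (i : nat) (y : option nat) : bool :=
  if y is Some j then (i <= j)%N else true.

Definition dominated x z : Prop := forall i, (i < N)%N -> le_queue (queue x i) (z i).

Lemma dominated_all x z i : dominated x z -> le_queue (queue x i) (z i).
Proof.
move=> xz; case: (ltnP i N) => [/xz//|Ni].
by rewrite queue_out //; case: (z i).
Qed.

Lemma dominated_arrive x z : dominated x z -> dominated (move None x) (arrival z).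
Proof.
move=> xz i iN; have := xz i iN; rewrite queue_move_arrive /arrival.
case: eqVneq => [->|] //=; case: (z 0%N) => [j|] //=; case: ifP => // _ h.
  by rewrite (leq_trans (geq_minl _ _)).
exact: leq_trans h _.
Qed.

Lemma dominated_serve x z (n : 'I_N) :
  dominated x z -> dominated (move (Some n) x) (service n z).
Proof.
move=> xz i iN; have xi := dominated_all i xz.
have xn := dominated_all n xz; have xn1 := dominated_all n.+1 xz.
rewrite queue_move_serve /service.
have [->|ni] := eqVneq i n.
  rewrite (fun_if (fun f => f (n : nat))) eqxx.
  move: (queue x n) (queue x n.+1) (z n) (z n.+1) xn xn1.
  move=> u v [a|] [b|] //= ua vb; last by case: ifP => _ //; apply: leq_trans (leq_pred _) ua.
  by case: (ltnP v u) => vu; case: (ltnP b a) => ba /=; lia.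
have [E|ni1] := eqVneq i n.+1; last first.
  by rewrite /= if_same (fun_if (fun f => f i)) (negbTE ni) (negbTE ni1) if_same.
rewrite E in iN *; rewrite iN /=.
rewrite (fun_if (fun f => f n.+1)) eqxx (_ : (n.+1 == n) = false) 1?eqxx; last by lia.
move: (queue x n) (queue x n.+1) (z n) (z n.+1) xn xn1.
move=> u v [a|] [b|] //= ua vb.
- by case: (ltnP v u) => vu; case: (ltnP b a) => ba /=; lia.
- by case: ifP => _ /=; lia.
Qed.

Variables (a : R -> nat) (s : nat -> R -> nat) (q : R -> state R).

Definition clock (c : option 'I_N) : R -> nat := if c is Some n then s n else a.

Hypothesis qpath : bp_path a s q.
Hypothesis clock_mono : forall c u v, 0 <= u -> u <= v -> (clock c u <= clock c v)%N.
Hypothesis clock_right : forall c t, 0 <= t -> clock c u @[u --> t^'+] --> clock c t.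

Lemma path_right n t : 0 <= t -> exp_neg R (q u n) @[u --> t^'+] --> exp_neg R (q t n).
Proof. by case: qpath => _ qr _ t0; apply: coord_cvg; apply: qr. Qed.

(** Points of later clocks may accumulate everywhere, but a service at m >= N changes only the
    coordinates m and m + 1. So the first N coordinates are left-continuous away from the points of
    the arrivals and of the first N service clocks. *)
Lemma path_left tau n : 0 < tau -> (n < N)%N -> (forall c, ~ point_of (clock c) tau) ->
  exp_neg R (q u n) @[u --> tau^'-] --> exp_neg R (q tau n).
Proof.
case: qpath => _ _ dyn tau0 nN nopt; have [ql [qlcv qa qs qn]] := dyn tau tau0.
suff -> : q tau n = ql n by apply: coord_cvg.
have [[m ptm]|nos] := pselect (exists m, point_of (s m) tau); last first.
  by rewrite qn // => [/(nopt None)//|m ptm]; apply: nos; exists m.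
rewrite (qs m) // /service; case: ifP => // _.
have Nm : (N <= m)%N.
  by rewrite leqNgt; apply/negP => mN; apply: (nopt (Some (Ordinal mN))).
have -> : (n == m) = false by lia.
by have -> : (n == m.+1) = false by lia.
Qed.

Lemma no_point c t1 t2 tau : 0 <= t1 -> t1 < tau <= t2 ->
  clock c t2 = clock c t1 -> ~ point_of (clock c) tau.
Proof.
move=> t10 /andP[t1t tt2] E [tau0 jump].
have := jump t1; rewrite t10 t1t => /(_ isT).
by rewrite ltnNge -E clock_mono // ltW.
Qed.

Lemma path_constant t1 t2 n : 0 <= t1 -> t1 <= t2 -> (n < N)%N ->
  (forall c tau, t1 < tau <= t2 -> ~ point_of (clock c) tau) -> q t2 n = q t1 n.
Proof.
move=> t10 t12 nN nopt; apply: (@constant_on_closed _ (fun u => q u n)) => //.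
  exact: path_right.
move=> tau t1tau; apply: path_left => // [|c]; last exact: nopt.
by case/andP: t1tau => /(le_lt_trans t10).
Qed.

(** The relevant clocks ring at most once in the interval. The first N coordinates are constant
    before and after that point, where the finite tandem makes the matching move below the left
    limit of the path. *)
Lemma path_step (w : option (option 'I_N)) t1 t2 x :
  0 <= t1 -> t1 <= t2 ->
  (forall c, (clock c t2 - clock c t1 = (w == Some c))%N) ->
  dominated x (q t1) -> dominated (if w is Some c then move c x else x) (q t2).
Proof.
move=> t10 t12 inc xq.
have flat c : w != Some c -> clock c t2 = clock c t1.
  move=> /negbTE wc; apply/eqP; rewrite eqn_leq (clock_mono c t10 t12) andbT.
  by rewrite -subn_eq0 inc wc.
case: w inc flat => [c|] inc flat; last first.
  move=> i iN; rewrite (path_constant t10 t12 iN) ?xq // => c tau h.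
  exact: (no_point t10 h (flat c _)).
have cinc : clock c t2 = (clock c t1).+1.
  by have := inc c; rewrite eqxx /=; clear; lia.
have [tau [/andP[t1t tt2] pt uni]] := counting_jump t10 t12 (@clock_mono c) (@clock_right c) cinc.
have nopt c' sg : t1 < sg <= t2 -> sg != tau -> ~ point_of (clock c') sg.
  move=> h ne; have [->|cc] := eqVneq c' c; first exact: uni.
  by apply: (no_point t10 h); apply: flat; apply: contra_neq cc => -[].
have tau0 := le_lt_trans t10 t1t.
have [_ _ /(_ tau tau0)[ql [qlcv qa qs _]]] := qpath.
have ql1 i : (i < N)%N -> ql i = q t1 i.
  move=> iN; apply: (@left_limit_constant _ (fun u => q u i) _ t1 tau) => //.
  - exact: path_right.
  - move=> sg /andP[t1s st]; apply: path_left => // [|c']; first exact: le_lt_trans t1s.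
    by apply: nopt; rewrite ?t1s ?(ltW (lt_le_trans st tt2)) ?lt_eqF.
  - exact: coord_cvg.
have xql : dominated x ql by move=> i iN; rewrite ql1 // xq.
have xtau : dominated (move c x) (q tau).
  case: c pt {cinc uni nopt inc flat} => [n|] pt.
    by rewrite (qs n) //; apply: dominated_serve.
  by rewrite qa //; apply: dominated_arrive.
move=> i iN; rewrite (path_constant (ltW tau0) tt2 iN) ?xtau // => c' sg /andP[ts st2].
by apply: nopt; rewrite ?(lt_trans t1t ts) ?st2 ?gt_eqF.
Qed.

End path_comparison.

(** * From the chain to continuous time *)

Section poissonized_kernel.
Variables (R : realType) (O C : finType) (r : C -> R) (phi : C -> O -> O).
Implicit Types (f : O -> R) (x : O).

(** One cell of a time grid of mesh h: no event has weight 1 and the single event c has weight h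
    r(c). Cells with several events are discarded, and the exponential factor of the cell is
    restored later. *)
Definition grid_step (h : R) f x : R := f x + h * \sum_c r c * f (phi c x).

Hypotheses (r_ge0 : forall c, 0 <= r c) (rate_gt0 : 0 < rate_sum r).

Local Notation P := (kernel r phi).
Local Notation Lam := (rate_sum r).

Lemma grid_stepE h f x : grid_step h f x = f x + h * Lam * P f x.
Proof. by rewrite /grid_step /kernel; congr (_ + _); field; rewrite gt_eqF. Qed.

Lemma iter_grid_step h f M x :
  iter M (grid_step h) f x =
  \sum_(j < M.+1) 'C(M, j)%:R * (h * Lam) ^+ j * iter j P f x.
Proof.
elim: M x => [|M IH] x.
  by rewrite big_ord_recl big_ord0 bin0 expr0 !mul1r addr0.
rewrite iterS grid_stepE IH; set u := h * Lam in IH *.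
rewrite (@eq_kernel _ _ _ r phi _ (fun y => \sum_(j < M.+1)
  ('C(M, j)%:R * u ^+ j * iter j P f y))) //.
rewrite kernel_sum big_ord_recl [in RHS]big_ord_recl -addrA !bin0.
congr (_ + _).
under [in LHS]eq_bigr do rewrite lift0.
under [in RHS]eq_bigr do rewrite lift0 binS natrD 2!mulrDl.
rewrite [RHS]big_split /= [in RHS]big_ord_recr /= bin_small // !mul0r addr0.
rewrite mulr_sumr.
congr (_ + _); apply: eq_bigr => j _.
by rewrite kernelZ exprS; ring.
Qed.

Variables (le : rel O) (bot : O).
Hypothesis le_bot : forall x, le bot x.
Hypothesis phi_mono : forall c x y, le x y -> le (phi c x) (phi c y).

(** In the binomial expansion, the terms with j >= m jumps are at least the value after m jumps, by
    monotonicity from [bot]. Those with j < m are dropped, at a cost bounded through C(M, j) u^j <=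
    (M u)^j. *)
Lemma iter_grid_step_ge h f M m : 0 <= h -> increasing le f -> (forall y, 0 <= f y) ->
  iter m P f bot * ((1 + h * Lam) ^+ M - \sum_(j < m) (M%:R * (h * Lam)) ^+ j)
    <= iter M (grid_step h) f bot.
Proof.
move=> h0 fi f0; rewrite iter_grid_step.
have u0 : 0 <= h * Lam by rewrite mulr_ge0 // ltW.
move: (h * Lam) u0 => u u0; set g := iter m P f bot.
have g0 j : 0 <= iter j P f bot.
  elim: j bot => //= j IH x; rewrite /kernel divr_ge0 ?(ltW rate_gt0) //.
  by rewrite sumr_ge0 // => c _; rewrite mulr_ge0.
have term0 (j : nat) : 0 <= 'C(M, j)%:R * u ^+ j by rewrite mulr_ge0 ?exprn_ge0.
have E : (1 + u) ^+ M = \sum_(j < M.+1) 'C(M, j)%:R * u ^+ j.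
  rewrite exprDn.
  apply: eq_bigr => j _; by rewrite expr1n mul1r mulr_natl.
have ab j : 'C(M, j)%:R * u ^+ j <= (M%:R * u) ^+ j.
  rewrite exprMn ler_wpM2r ?exprn_ge0 // -natrX ler_nat.
  apply: leq_trans (leq_pmulr _ (fact_gt0 j)) _; rewrite bin_ffact.
  by elim: j => // j IHj; rewrite ffactnSr expnSr leq_mul // leq_subr.
have b0 j : 0 <= (M%:R * u) ^+ j by rewrite exprn_ge0 // mulr_ge0.
have small : \sum_(j < M.+1 | (j < m)%N) (M%:R * u) ^+ j <= \sum_(j < m) (M%:R * u) ^+ j.
  rewrite (big_ord_widen (M.+1 + m)%N (fun j => (M%:R * u) ^+ j)) ?leq_addl //.
  rewrite [leLHS](big_ord_widen_cond (M.+1 + m)%N (fun j => (j < m)%N)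
    (fun j => (M%:R * u) ^+ j)) ?leq_addr //.
  rewrite [leLHS]big_mkcond [leRHS]big_mkcond /=; apply: ler_sum => j _.
  by case: ifP => [/andP[-> _]|_] //; case: ifP.
rewrite mulrBr E mulr_sumr lerBlDr.
apply: (@le_trans _ _ (\sum_(j < M.+1) 'C(M, j)%:R * u ^+ j * iter j P f bot
    + g * \sum_(j < M.+1 | (j < m)%N) (M%:R * u) ^+ j)); last first.
  by rewrite lerD2l ler_wpM2l ?g0.
rewrite [X in _ * X]big_mkcond mulr_sumr -big_split; apply: ler_sum => j _ /=.
case: ltnP => jm.
  apply: ler_wpDl; first exact: mulr_ge0.
  by apply: ler_wpM2l; [apply: g0|apply: ab].
rewrite mulr0 addr0 mulrC; apply: ler_wpM2l => //.
exact: (iter_kernel_bot_nondecreasing le_bot r_ge0 rate_gt0 phi_mono fi).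
Qed.

End poissonized_kernel.

(** * Estimates for the discarded cells and the early jumps *)

Section exponential_estimates.
Variable R : realType.

(** From 1 + u >= exp(u / (1 + u)) with u = tau / M: the exponents combine to - tau u / (1 + u) >= -
    tau^2 / M, and e^x >= 1 + x. This is the loss from cells with several events. *)
Lemma expRN_pow_ge (tau : R) (M : nat) : 0 <= tau -> (0 < M)%N ->
  1 - tau ^+ 2 / M%:R <= expR (- tau) * (1 + tau / M%:R) ^+ M.
Proof.
move=> t0 M0; have Mr : 0 < M%:R :> R by rewrite ltr0n.
set u := tau / M%:R; have u0 : 0 <= u by rewrite divr_ge0 // ltW.
have u1 : 0 < 1 + u by rewrite ltr_wpDr.
have tE : tau = M%:R * u by rewrite /u mulrC divfK // gt_eqF.
have h : expR (u / (1 + u)) <= 1 + u.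
  rewrite -[leRHS]invrK -[leLHS]invrK -expRN lef_pV2 ?posrE ?invr_gt0 ?expR_gt0 //.
  apply: le_trans (expR_ge1Dx _); rewrite le_eqVlt; apply/orP; left.
  by apply/eqP; field; rewrite gt_eqF.
apply: (@le_trans _ _ (expR (- tau) * expR (u / (1 + u)) ^+ M)); last first.
  by rewrite ler_wpM2l ?expR_ge0 // lerXn2r ?nnegrE ?expR_ge0 // ltW.
rewrite -expRM_natl -expRD (le_trans _ (expR_ge1Dx _)) // lerD2l.
have -> : - tau + M%:R * (u / (1 + u)) = - (tau * (u / (1 + u))).
  by rewrite tE; field; rewrite gt_eqF.
rewrite lerN2 expr2 -mulrA ler_wpM2l // ler_pdivrMr // -/u.
by rewrite mulrDr mulr1 lerDl mulr_ge0.
Qed.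

(** For tau >= 1 the sum is at most m tau^m, while the exponential is at least (tau / (m + 1))^(m +
    1), one power more. *)
Lemma expRN_poly_small m (eps : R) : 0 < eps ->
  exists t0 : R, forall tau, t0 <= tau ->
    expR (- tau) * \sum_(j < m) tau ^+ j <= eps.
Proof.
move=> eps0; pose c : R := m%:R * m.+1%:R ^+ m.+1.
have c0 : 0 <= c by rewrite mulr_ge0 ?exprn_ge0 ?ler0n.
exists (1 + c / eps) => tau ht.
have t1 : 1 <= tau by rewrite (le_trans _ ht) // lerDl divr_ge0 // ltW.
have t0 : 0 < tau by apply: lt_le_trans t1.
have sum_le : \sum_(j < m) tau ^+ j <= m%:R * tau ^+ m.
  apply: (@le_trans _ _ (\sum_(j < m) tau ^+ m)).
    by apply: ler_sum => j _; apply: ler_weXn2l => //; apply: ltnW.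
  by rewrite sumr_const card_ord mulr_natl.
have exp_ge : (tau / m.+1%:R) ^+ m.+1 <= expR tau.
  have -> : expR tau = expR (tau / m.+1%:R) ^+ m.+1.
    by rewrite -expRM_natl mulrC divfK // pnatr_eq0.
  rewrite lerXn2r ?nnegrE ?expR_ge0 ?divr_ge0 ?ler0n ?(ltW t0) //.
  by rewrite (le_trans _ (expR_ge1Dx _)) // lerDr.
rewrite expRN mulrC ler_pdivrMr ?expR_gt0 //.
apply: le_trans sum_le _; apply: (@le_trans _ _ (eps * (tau / m.+1%:R) ^+ m.+1)).
  rewrite expr_div_n mulrA ler_pdivlMr ?exprn_gt0 ?ltr0n //.
  rewrite mulrAC -/c exprS mulrA ler_wpM2r ?exprn_ge0 ?(ltW t0) //.
  rewrite -ler_pdivrMl // mulrC (le_trans _ ht) // lerDr ler01 //.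
by rewrite ler_wpM2l // ltW.
Qed.

End exponential_estimates.

(** * Words of events *)

Section words.
Variables (R : realType) (O C : finType) (r : C -> R) (phi : C -> O -> O).

(* The letter [None] stands for a time interval without events. *)
Definition letter_act (l : option C) (x : O) : O := if l is Some c then phi c x else x.

Definition run (w : seq (option C)) (x : O) : O := foldl (fun y l => letter_act l y) x w.

Definition letter_weight (h : R) (l : option C) : R := if l is Some c then r c * h else 1.

Lemma sum_words (h : R) (f : O -> R) M x :
  \sum_(w : M.-tuple (option C)) (\prod_(l <- w) letter_weight h l) * f (run w x)
  = iter M (grid_step r phi h) f x.
Proof.
elim: M x => [|M IH] x.
  rewrite (big_pred1 [tuple]) => [|w]; first by rewrite big_nil mul1r.
  by apply/esym/eqP; apply: tuple0.
pose g (p : option C * M.-tuple (option C)) : M.+1.-tuple (option C) := [tuple of p.1 :: p.2].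
pose g' (w : M.+1.-tuple (option C)) := (thead w, [tuple of behead w]).
rewrite (reindex g); last first.
  exists g' => [[l w] _|w _]; rewrite /g' /g /=.
    by rewrite theadE; congr pair; apply: val_inj.
  by rewrite -tuple_eta.
rewrite -(pair_bigA _ (fun l (w : M.-tuple _) =>
  \prod_(l' <- l :: w) letter_weight h l' * f (run (l :: w) x))) /=.
rewrite sum_option /grid_step; congr (_ + _).
  rewrite -IH; apply: eq_bigr => w _; by rewrite big_cons /= mul1r.
rewrite mulr_sumr; apply: eq_bigr => c _; rewrite mulrA -IH mulr_sumr.
by apply: eq_bigr => w _; rewrite big_cons /= -!mulrA mulrCA mulrA.
Qed.

End words.

Lemma in_big_setI (T : Type) (I : choiceType) (s : seq I) (F : I -> set T) w :
  (\big[setI/setT]_(i <- s) F i) w <-> forall i, i \in s -> F i w.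
Proof. by rewrite -bigcap_seq. Qed.

Lemma measurable_nat_sub d (X : measurableType d) (f g : X -> nat) b :
  (forall a, measurable (f @^-1` [set a])) -> (forall a, measurable (g @^-1` [set a])) ->
  measurable [set w | (f w - g w)%N = b].
Proof.
move=> mf mg.
rewrite (_ : [set w | _] = \bigcup_a (g @^-1` [set a] `&` \bigcup_(c in [set c | (c - a)%N = b])
    f @^-1` [set c])).
  apply: bigcupT_measurable => a; apply: measurableI => //.
  by apply: bigcup_measurable => c _.
apply/seteqP; split => [w fg|w [a _ [/= <- [c /= cb ->]]]] //.
by exists (g w) => //; split => //; exists (f w).
Qed.

Lemma sum_disjoint_le d (T : measurableType d) (R : realType) (P : probability T R)
    (I : eqType) (s : seq I) (E : I -> set T) (B : set T) :
  uniq s -> measurable B -> (forall i, i \in s -> measurable (E i)) ->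
  (forall i, i \in s -> E i `<=` B) ->
  (forall i j, i \in s -> j \in s -> i != j -> E i `&` E j = set0) ->
  (\sum_(i <- s) P (E i) <= P B)%E.
Proof.
elim: s B => [|i s IH] B; first by rewrite big_nil measure_ge0.
rewrite cons_uniq => /andP[nis us] mB mE EB dis; rewrite big_cons.
have iE : i \in i :: s by rewrite mem_head.
have sub j : j \in s -> j \in i :: s by move=> js; rewrite in_cons js orbT.
rewrite (measureDI P mB (mE i iE)) addeC setIC (setIidl (EB i iE)) leeD2r //.
apply: IH => //.
- by apply: measurableD => //; apply: mE.
- by move=> j /sub; apply: mE.
- move=> j js w Ejw; split; first exact: EB (sub _ js) _ Ejw.
  move=> Eiw; have := dis i j iE (sub _ js).
  have ij : i != j by apply: contraNneq nis => ->.
  move=> /(_ ij) E0; have : (E i `&` E j) w by [].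
  by rewrite E0.
- by move=> j k /sub js /sub ks; apply: dis.
Qed.

(** * Probability of a word under the Poisson clocks *)

Section grid_lower_bound.
Context (R : realType) d (T : measurableType d) (P : probability T R).
Variables (lam : R) (A : R -> {RV P >-> nat}) (S : nat -> R -> {RV P >-> nat}).
Variable (Q : R -> T -> state R).
Hypotheses (lam_gt0 : 0 < lam) (bp : backpressure_process lam A S Q).

Definition point_process (j : option nat) : R -> {RV P >-> nat} :=
  if j is Some n then S n else A.

(** Under truncated subtraction this event contains the one whose probability the Poisson law gives,
    which is enough for lower bounds. *)
Definition increment (j : option nat) (t t' : R) (b : nat) : set T :=
  [set w | (point_process j t' w - point_process j t w)%N = b].

Definition point_rate (j : option nat) : R := if j is Some _ then 1 else lam.

Lemma point_rate_gt0 j : 0 < point_rate j. Proof. by case: j => /=. Qed.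

Lemma point_process_poisson j : poisson_process (point_rate j) (point_process j).
Proof. by case: j => [n|]; [apply: (bp_services bp)|apply: (bp_arrivals bp)]. Qed.

Lemma measurable_level (X : {RV P >-> nat}) a : measurable (X @^-1` [set a]).
Proof. by rewrite -[X in measurable X]setTI; apply: measurable_funP. Qed.

Lemma measurable_increment j t t' b : measurable (increment j t t' b).
Proof. by apply: measurable_nat_sub => a; apply: measurable_level. Qed.

Lemma increment_sigma j t t' b : 0 <= t -> 0 <= t' ->
  sigma_process (point_process j) (increment j t t' b).
Proof.
move=> t0 t'0; rewrite /sigma_process; set G := (X in <<s X >>).
have level u a : 0 <= u -> <<s G >> (point_process j u @^-1` [set a]).
  move=> u0; apply: sub_sigma_algebra; exists u => //.
  by exists [set a] => //; rewrite setTI.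
apply: (@measurable_nat_sub _ (g_sigma_algebraType G)) => a; exact: level.
Qed.

Lemma increment_ge j t t' b : 0 <= t -> t < t' ->
  ((poisson_pmf (point_rate j * (t' - t)) b)%:E <= P (increment j t t' b))%E.
Proof.
move=> t0 tt'; rewrite -(poisson_increment (point_process_poisson j)) //.
apply: le_measure; rewrite ?inE.
- rewrite (_ : [set w | _] = \bigcup_a (point_process j t @^-1` [set a] `&`
      point_process j t' @^-1` [set (a + b)%N])).
    by apply: bigcupT_measurable => a; apply: measurableI; apply: measurable_level.
  apply/seteqP; split => [w /= E|w [a _ [/= <- //]]].
  by exists (point_process j t w).
- exact: measurable_increment.
- by move=> w /= E; rewrite /increment /= E addKn.
Qed.

Variables (M : nat) (h : R).
Hypothesis h_gt0 : 0 < h.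

Definition grid (i : nat) : R := i%:R * h.

Lemma grid_ge0 i : 0 <= grid i.
Proof. by rewrite mulr_ge0 // ltW. Qed.

Lemma gridS i : grid i.+1 - grid i = h.
Proof. by rewrite /grid -natr1 mulrDl mul1r addrAC subrr add0r. Qed.

Lemma grid_lt i : grid i < grid i.+1.
Proof. by rewrite -subr_gt0 gridS. Qed.

Definition clock_event (j : option nat) (b : nat -> nat) : set T :=
  \big[setI/setT]_(i <- iota 0 M) increment j (grid i) (grid i.+1) (b i).

Lemma clock_event_sigma j b : sigma_process (point_process j) (clock_event j b).
Proof.
rewrite /clock_event; elim: (iota 0 M) => [|i s IH].
  by rewrite big_nil; apply: (@measurableT _ (g_sigma_algebraType _)).
rewrite big_cons; apply: (@measurableI _ (g_sigma_algebraType _)) => //.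
by apply: increment_sigma; apply: grid_ge0.
Qed.

Lemma clock_event_ge j b :
  ((\prod_(i <- iota 0 M) poisson_pmf (point_rate j * h) (b i))%:E
    <= P (clock_event j b))%E.
Proof.
rewrite /clock_event.
have -> := poisson_independent_increments (point_process_poisson j) (grid_ge0 0)
  (fun i => ltW (grid_lt i)) (s := iota 0 M)
  (E := fun i => increment j (grid i) (grid i.+1) (b i)) (iota_uniq 0 M).
  elim: (iota 0 M) => [|i s IH]; first by rewrite !big_nil.
  rewrite !big_cons EFinM lee_pmul ?lee_fin ?poisson_pmf_ge0 //.
    by rewrite prodr_ge0 // => k _; apply: poisson_pmf_ge0.
  by rewrite -(gridS i) increment_ge ?grid_ge0 ?grid_lt.
by move=> i _; exists [set b i] => //; rewrite setTI.
Qed.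

Variables (L K : nat).
Local Notation N := L.+1.
Local Notation letter := (option (option 'I_N)).

Definition site_clock (c : option 'I_N) : option nat := omap val c.

Lemma site_clock_inj : injective site_clock.
Proof. by case=> [i|] [j|] //= [/val_inj ->]. Qed.

Definition letter_count (w : seq letter) (j : option nat) (i : nat) : nat :=
  (omap site_clock (nth None w i) == Some j).

Lemma letter_countE w c i :
  letter_count w (site_clock c) i = (nth None w i == Some c).
Proof.
rewrite /letter_count; congr nat_of_bool; case: (nth None w i) => //= c'.
by apply/eqP/eqP => [[/site_clock_inj ->]|[->]].
Qed.

(** In each of the M cells the clock named by the letter has increment one and the other clocks of
    the tandem have increment zero. The events are grouped by clock, so that independence of the
    clocks and then of the increments applies. *)
Definition word_event (w : seq letter) : set T :=
  \big[setI/setT]_(j <- map site_clock (enum {: option 'I_N}))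
    clock_event j (letter_count w j).

Lemma measurable_word_event w : measurable (word_event w).
Proof.
rewrite /word_event; elim: (map _ _) => [|j s IH]; first by rewrite big_nil.
rewrite big_cons; apply: measurableI => //; rewrite /clock_event.
elim: (iota 0 M) => [|i r IHr]; first by rewrite big_nil.
by rewrite big_cons; apply: measurableI => //; apply: measurable_increment.
Qed.

Lemma word_eventP w : size w = M -> forall om, word_event w om <->
  forall (c : option 'I_N) i, (i < M)%N ->
    (point_process (site_clock c) (grid i.+1) om
       - point_process (site_clock c) (grid i) om = (nth None w i == Some c))%N.
Proof.
move=> sw om; rewrite /word_event in_big_setI; split => [H c i iM|H j].
  have /H : site_clock c \in map site_clock (enum {: option 'I_N}).
    by rewrite map_f // mem_enum.
  rewrite /clock_event in_big_setI => /(_ i); rewrite mem_iota iM => /(_ isT) ->.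
  exact: letter_countE.
move=> /mapP[c _ ->]; rewrite /clock_event in_big_setI => i; rewrite mem_iota => /= iM.
by rewrite /increment /= H // letter_countE.
Qed.

Lemma word_event_disjoint w w' : size w = M -> size w' = M -> w != w' ->
  word_event w `&` word_event w' = set0.
Proof.
move=> sw sw' ww'; apply/seteqP; split => // om [/(word_eventP sw) H /(word_eventP sw') H'].
case/eqP: ww'; apply: (@eq_from_nth _ None); first by rewrite sw.
move=> i; rewrite sw => iM.
have E c : (nth None w i == Some c) = (nth None w' i == Some c).
  by have := H c i iM; rewrite (H' c i iM); case: (_ == _); case: (_ == _).
case: (nth None w i) E => [c|] E; first by apply/esym/eqP; rewrite -E.
by case: (nth None w' i) E => // c /(_ c); rewrite eqxx.
Qed.

Definition weight (w : seq letter) : R :=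
  expR (- (rate_sum (rate lam (N := N)) * h)) ^+ M *
  \prod_(l <- w) letter_weight (rate lam (N := N)) h l.

Lemma poisson_pmf_bool (x : R) (b : bool) : 0 < x ->
  poisson_pmf x b = expR (- x) * (if b then x else 1).
Proof.
by move=> x0; rewrite /poisson_pmf x0; case: b;
  rewrite /= ?expr0 ?expr1 divr1 mulrC.
Qed.

Lemma letter_prob (l : letter) :
  \prod_(c : option 'I_N) poisson_pmf (point_rate (site_clock c) * h) (l == Some c)
  = expR (- (rate_sum (rate lam (N := N)) * h)) * letter_weight (rate lam (N := N)) h l.
Proof.
have rE c : point_rate (site_clock c) = rate lam (N := N) c by case: c.
under eq_bigr => c _.
  rewrite poisson_pmf_bool ?mulr_gt0 ?point_rate_gt0 // rE.
  over.
rewrite big_split /=; congr (_ * _).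
  by rewrite -expR_sum sumrN -mulr_suml.
case: l => [c|]; last by rewrite big1.
rewrite (bigD1 c) //= eqxx big1 ?mulr1 // => c' cc'.
by case: eqP => // -[E]; rewrite E eqxx in cc'.
Qed.

Lemma weightE w : size w = M ->
  weight w = \prod_(c <- enum {: option 'I_N}) \prod_(i <- iota 0 M)
    poisson_pmf (point_rate (site_clock c) * h) (letter_count w (site_clock c) i).
Proof.
move=> sw; rewrite big_enum exchange_big /=.
under [RHS]eq_bigr => i _.
  under eq_bigr do rewrite letter_countE.
  rewrite letter_prob; over.
rewrite big_split /= /weight; congr (_ * _).
  by rewrite big_const_seq count_predT size_iota iter_mulr_1.
by rewrite (big_nth None) sw /index_iota subn0.
Qed.

Lemma word_event_ge w : size w = M -> ((weight w)%:E <= P (word_event w))%E.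
Proof.
move=> sw; rewrite /word_event.
have -> := bp_independent bp (s := map site_clock (enum {: option 'I_N}))
  (E := fun j => clock_event j (letter_count w j)).
- rewrite big_map weightE //.
  elim: (enum _) => [|c s IH]; first by rewrite !big_nil.
  rewrite !big_cons EFinM lee_pmul ?clock_event_ge ?lee_fin ?prodr_ge0 // => i _.
    by rewrite poisson_pmf_ge0.
  by rewrite prodr_ge0 // => k _; rewrite poisson_pmf_ge0.
- by rewrite map_inj_uniq ?enum_uniq //; apply: site_clock_inj.
- move=> j _; exact: clock_event_sigma.
Qed.

Definition path_regular (om : T) : Prop :=
  bp_path (A^~ om) (fun n t => S n t om) (Q^~ om) /\
  forall (j : option nat),
    (forall u v, 0 <= u -> u <= v -> (point_process j u om <= point_process j v om)%N) /\
    (forall t, 0 <= t -> point_process j u om @[u --> t^'+] --> point_process j t om).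

Lemma path_regular_ae : {ae P, forall om, path_regular om}.
Proof.
have reg j : {ae P, forall om,
    (forall u v, 0 <= u -> u <= v -> (point_process j u om <= point_process j v om)%N) /\
    (forall t, 0 <= t -> point_process j u om @[u --> t^'+] --> point_process j t om)}.
  apply: filterS2 (poisson_nondecreasing (point_process_poisson j))
    (poisson_right_continuous (point_process_poisson j)) => om H1 H2; by split.
have regS := ae_foralln (fun n => reg (Some n)).
apply: filterS3 (bp_dynamics bp) (reg None) regS => om H1 H2 H3; by split => // -[n|].
Qed.

Lemma word_dominated w om : size w = M -> path_regular om ->
  word_event w om ->
  dominated (run (@move N K) w (empty N K)) (Q (grid M) om).
Proof.
move=> sw [qp reg] /(word_eventP sw) H; rewrite -[w]take_size sw.
have cE c u : clock (A^~ om) (fun n t => S n t om) c u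
    = point_process (@site_clock c) u om by case: c.
suff step i : (i <= M)%N -> dominated (run (@move N K) (take i w) (empty N K)) (Q (grid i) om).
  exact: step.
elim: i => [_|i IH iM].
  rewrite take0 /grid mul0r; have [-> _ _] := qp => k kN.
  by rewrite queue_empty.
rewrite (take_nth None) ?sw // /run -cats1 foldl_cat /=.
apply: (path_step qp _ _ (grid_ge0 i) (ltW (grid_lt i)) _ (IH (ltnW iM))).
- by move=> c u v u0 uv; rewrite !cE; apply: (reg _).1.
- move=> c t t0; rewrite cE; under eq_fun do rewrite cE.
  by apply: (reg _).2.
- by move=> c; rewrite !cE; apply: H.
Qed.

End grid_lower_bound.

(** * Convergence of the queues *)

Section queue_limit.
Variable R : realType.

(** The threshold c lies strictly between e^-(k+1) and e^-k, so the event and its complement are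
    both open, and the indicator is an admissible test function. *)
Lemma le_queue_continuous k n :
  continuous (fun x : state R => ((le_queue k.+1 (x n))%:R : R)).
Proof.
pose c := (exp_neg R (Some k) + exp_neg R (Some k.+1)) / 2.
have kk1 : exp_neg R (Some k.+1) < exp_neg R (Some k).
  by rewrite ltNge exp_neg_Some_le ltnn.
have [c1 c2] : exp_neg R (Some k.+1) < c /\ c < exp_neg R (Some k).
  by rewrite /c addrC !(midf_lt kk1).
have cE y : (le_queue k.+1 y = (exp_neg R y < c)) * (~~ le_queue k.+1 y = (c < exp_neg R y)).
  case: y => [j|]; last first.
    have e0 := expR_gt0 (- k.+1%:R : R).
    have c0 : 0 < c := lt_trans e0 c1.
    by split; rewrite /= ?c0 // ltNge ltW.
  rewrite (_ : le_queue k.+1 (Some j) = (k < j)%N) //; case: (ltnP k j) => kj.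
    have h : exp_neg R (Some j) <= exp_neg R (Some k.+1) by rewrite exp_neg_Some_le.
    have hc := le_lt_trans h c1.
    by split; apply/esym => //; apply/negbTE; rewrite -leNgt ltW.
  have h : exp_neg R (Some k) <= exp_neg R (Some j) by rewrite exp_neg_Some_le.
  have hc := lt_le_trans c2 h.
  by split; apply/esym => //; apply/negbTE; rewrite -leNgt ltW.
move=> x; have xc := @exp_neg_coord_continuous R n x.
have near_cst : \forall y \near x,
    (le_queue k.+1 ((y : state R) n))%:R = (le_queue k.+1 (x n))%:R :> R.
  case: (boolP (le_queue k.+1 (x n))) => H.
    rewrite (cE _).1 in H; apply: filterS (cvgr_lt _ xc _ H) => y yc.
    by have -> : le_queue k.+1 (y n) by rewrite (cE _).1.
  rewrite (cE _).2 in H; apply: filterS (cvgr_gt _ xc _ H) => y yc.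
  by have /negbTE -> : ~~ le_queue k.+1 (y n) by rewrite (cE _).2.
move=> B nB; apply: filterS near_cst => y yx.
by rewrite /= yx; apply: nbhs_singleton nB.
Qed.

Lemma measurable_le_queue d (T : measurableType d) (X : T -> state R) k n :
  random_state X -> measurable [set w | le_queue k (X w n)].
Proof.
move=> mX; rewrite (_ : [set w | _] =
    ~` (\bigcup_(i in [set i | (i < k)%N]) [set w | X w n = Some i])).
  by apply: measurableC; apply: bigcup_measurable => i _; apply: mX.
apply/seteqP; split => [w /= + [i /= ik Xi]|w /= H].
  by rewrite Xi /= leqNgt ik.
case E : (X w n) => [j|] //=; rewrite leqNgt; apply/negP => jk.
by apply: H; exists j.
Qed.

Variables (d : measure_display) (T : measurableType d) (P : probability T R).
Variables (lam : R) (A : R -> {RV P >-> nat}) (S : nat -> R -> {RV P >-> nat}).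
Variable (Q : R -> T -> state R).
Hypotheses (lam_gt0 : 0 < lam) (bp : backpressure_process lam A S Q).

(** Events of distinct words are disjoint. Outside a null set, a word whose run ends with at least k
    customers at n forces the true queue to be that long. *)
Lemma queue_prob_ge_words M h L K n k : 0 < h ->
  ((expR (- (rate_sum (rate lam (N := L.+1)) * h)) ^+ M *
    iter M (grid_step (rate lam (N := L.+1)) (@move L.+1 K) h)
      (fun x => (k <= queue x n)%N%:R) (empty L.+1 K))%:E
    <= P [set om | le_queue k (Q (grid h M) om n)])%E.
Proof.
move=> h0; have [Z [mZ Z0 subZ]] := path_regular_ae bp.
have mB := measurable_le_queue k n (bp_measurable bp (grid_ge0 h0 M)).
set B := [set _ | _] in mB *.
pose good (w : M.-tuple (option (option 'I_L.+1))) :=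
  (k <= queue (run (@move L.+1 K) w (empty L.+1 K)) n)%N.
apply: (@le_trans _ _ (P (B `|` Z))); last first.
  rewrite (le_trans (measureU2 _ mB mZ)) // [X in (_ + X)%E](_ : _ = 0%E) ?adde0 //.
apply: (@le_trans _ _ (\sum_(w <- enum good) P (word_event A S M h w))%E); last first.
  apply: sum_disjoint_le => //.
  - exact: enum_uniq.
  - exact: measurableU.
  - by move=> w _; apply: measurable_word_event.
  - move=> w; rewrite mem_enum => gw om Ew.
    case: (pselect (path_regular A S Q om)) => [reg|nreg]; last by right; apply: subZ.
    left; have /(dominated_all n) := word_dominated h0 K (size_tuple w) reg Ew.
    rewrite /B /=; move: gw; rewrite /good unfold_in.
    by case: (Q _ om n) => //= j; apply: leq_trans.
  - move=> w w' _ _ ww'; apply: word_event_disjoint; rewrite ?size_tuple //.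
apply: (@le_trans _ _ (\sum_(w <- enum good) (weight lam M h w)%:E)%E); last first.
  rewrite big_seq [leRHS]big_seq; apply: lee_sum => w _.
  by apply: (word_event_ge lam_gt0 bp h0); rewrite size_tuple.
rewrite sumEFin lee_fin big_enum /= -sum_words mulr_sumr big_mkcond /=.
rewrite le_eqVlt; apply/orP; left; apply/eqP.
rewrite [RHS]big_mkcond; apply: eq_bigr => w _ /=.
rewrite /weight /good unfold_in; case: ifP => _; rewrite ?mulr0 ?mulr1 //.
Qed.


(** First m is fixed by [every_site_saturates], then a large t makes fewer than m jumps unlikely,
    and last, for each t, the mesh t / M is taken fine enough. *)
Lemma queue_prob_limit n k (eps : R) : 4^-1 < lam -> 0 < eps ->
  exists t0 : R, forall t, t0 <= t ->
    ((1 - eps)%:E <= P [set om | le_queue k (Q t om n)])%E.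
Proof.
(* Three errors of size e: the chain after m jumps, the discarded cells and the runs with fewer than
   m jumps. *)
move=> lam4 eps0; pose e := Num.min (eps / 3) 1.
have e0 : 0 < e by rewrite lt_min ltr01 divr_gt0.
have e1 : e <= 1 by rewrite ge_min lexx orbT.
have e3 : 3 * e <= eps by rewrite mulrC -ler_pdivlMr // ge_min lexx.
have [L [K [m Hg]]] := every_site_saturates n k lam4 e0.
have Lam0 := rate_sum_gt0 L lam_gt0; set Lam := rate_sum _ in Lam0.
have [t1 Ht1] := expRN_poly_small m e0.
exists (Num.max 1 (t1 / Lam)) => t; rewrite ge_max => /andP[t_ge1].
rewrite ler_pdivrMr // => t_ge; pose tau := t * Lam.
have t_gt0 : 0 < t by apply: lt_le_trans t_ge1.
have tau0 : 0 < tau by apply: mulr_gt0.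
have [M M0 HM] := exists_inv_le (divr_gt0 e0 (exprn_gt0 2 tau0)).
have Mr : 0 < M%:R :> R by rewrite ltr0n.
have h0 : 0 < t / M%:R by apply: divr_gt0.
have := queue_prob_ge_words M L K n k h0.
have -> : grid (t / M%:R) M = t by rewrite /grid mulrC divfK // gt_eqF.
apply: le_trans; rewrite lee_fin -/Lam.
have hE : t / M%:R * Lam = tau / M%:R by rewrite /tau mulrAC.
have MhE : M%:R * (t / M%:R * Lam) = tau.
  by rewrite hE mulrC divfK // gt_eqF.
have Eexp : expR (- (Lam * (t / M%:R))) ^+ M = expR (- tau).
  by rewrite -expRM_natl mulrN [Lam * _]mulrC MhE.
have := @iter_grid_step_ge R _ _ (rate lam (N := L.+1)) (@move L.+1 K)
  (rate_ge0 lam_gt0) (rate_sum_gt0 L lam_gt0) (@le_config L.+1 K) (empty L.+1 K)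
  (@le_config_bot _ _) (@move_mono L K) (t / M%:R)
  (fun x => (k <= queue x n)%N%:R) M m (ltW h0) (@queue_ge_increasing R L K n k).
rewrite -/(reach lam L K n k m) -/Lam MhE hE => /(_ (fun=> ler0n _ _)).
rewrite Eexp => /(ler_wpM2l (ltW (expR_gt0 (- tau)))); apply: le_trans.
have h1 := expRN_pow_ge (ltW tau0) M0.
have h2 := Ht1 _ t_ge; rewrite -/tau in h2.
have h3 : tau ^+ 2 / M%:R <= e.
  by rewrite -ler_pdivlMl ?exprn_gt0 // mulrC.
have /andP[g0 g1] := reach_bound L K lam_gt0 n k m.
rewrite mulrCA mulrBr.
have h4 : 1 - e - e <= expR (- tau) * (1 + tau / M%:R) ^+ M
    - expR (- tau) * \sum_(j < m) tau ^+ j by lra.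
apply: (@le_trans _ _ (reach lam L K n k m * (1 - e - e))); last by rewrite ler_wpM2l.
move: Hg g0 g1; move: (reach _ _ _ _ _ _) => g Hg g0 g1.
have : 0 <= (g - (1 - e)) * e by rewrite mulr_ge0 ?subr_ge0 // ltW.
have : 0 <= (1 - g) * e by rewrite mulr_ge0 ?subr_ge0 // ltW.
have : 0 <= (1 - e) * e by rewrite mulr_ge0 ?subr_ge0 // ltW.
clear -Hg g0 g1 e3 e0 e1; lra.
Qed.

Variables (d' : measure_display) (T' : measurableType d') (P' : probability T' R).
Variable (Qinf : T' -> state R).
Hypotheses (mQinf : random_state Qinf) (Qcvg : cvg_in_distribution P Q P' Qinf).

Lemma expectation_le_queue e (X : measurableType e) (mu : probability X R)
    (Y : X -> state R) k n : random_state Y ->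
  'E_mu[(fun x : state R => (le_queue k (x n))%:R : R) \o Y]%E
    = mu [set w | le_queue k (Y w n)].
Proof.
move=> mY; rewrite -(expectation_indic mu (measurable_le_queue k n mY)).
congr expectation; apply/funext => w /=.
by rewrite indicE /=; congr (_%:R); apply/esym; rewrite mem_setE.
Qed.

Lemma limit_queue_unbounded n k : 4^-1 < lam ->
  P' [set w | le_queue k.+1 (Qinf w n)] = 1%E.
Proof.
move=> lam4; apply/eqP; rewrite eq_le probability_le1 /=; last exact: measurable_le_queue.
rewrite -expectation_le_queue //.
have bound : exists B, forall x : state R, `|(le_queue k.+1 (x n))%:R : R| <= B.
  by exists 1 => x; case: le_queue; rewrite ?normr1 ?normr0.
have lim := Qcvg (@le_queue_continuous k n) bound.
apply/lee_addgt0Pr => eps eps0; rewrite -leeBlDr //.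
apply: cvge_ge lim.
have [t0 Ht0] := queue_prob_limit n k.+1 lam4 eps0.
near=> t; rewrite expectation_le_queue.
  by apply: Ht0; near: t; apply: nbhs_pinfty_ge; rewrite num_real.
by apply: (bp_measurable bp); near: t; apply: nbhs_pinfty_ge; rewrite num_real.
Unshelve. all: by end_near. Qed.

(** Each finite value k is null because the queue is almost surely at least k + 1, and there are
    countably many of them. *)
Lemma limit_queue_infinite n : 4^-1 < lam -> P' [set w | Qinf w n = None] = 1%E.
Proof.
move=> lam4.
have mF k : measurable [set w | Qinf w n = Some k] by apply: mQinf.
have null : P' (\bigcup_k [set w | Qinf w n = Some k]) = 0%E.
  apply/(negligibleP _ (bigcupT_measurable _ mF)); apply: negligible_bigcup => k.
  apply/(negligibleP _ (mF k)).
  apply/eqP; rewrite eq_le measure_ge0 andbT.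
  have mB := measurable_le_queue k.+1 n mQinf.
  have E0 : P' (~` [set w | le_queue k.+1 (Qinf w n)]) = 0%E.
    by rewrite probability_setC // limit_queue_unbounded // subee.
  rewrite -[leRHS]E0; apply: le_measure; rewrite ?inE //; first exact: measurableC.
  by move=> w /= ->; rewrite /= ltnn.
rewrite (_ : [set w | _] = ~` (\bigcup_k [set w | Qinf w n = Some k])).
  by rewrite probability_setC ?null ?sube0 //; apply: bigcupT_measurable.
apply/seteqP; split => [w /= E [k _ /=]|w /= H]; first by rewrite E.
by case E : (Qinf w n) => [k|] //; case: H; exists k.
Qed.

End queue_limit.

Theorem theorem10 (R : realType) (lambda : R)
    (d : measure_display) (T : measurableType d) (P : probability T R)
    (A : R -> {RV P >-> nat}) (S : nat -> R -> {RV P >-> nat})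
    (Q : R -> T -> state R)
    (d' : measure_display) (T' : measurableType d') (P' : probability T' R)
    (Qinf : T' -> state R) :
  4^-1 < lambda ->
  backpressure_process lambda A S Q ->
  random_state Qinf ->
  cvg_in_distribution P Q P' Qinf ->
  P' [set w | Qinf w 0%N = None] = 1%E /\
  forall n : nat, P' [set w | Qinf w n = None] = 1%E.
Proof.
move=> lam4 bp mQ Qcvg.
have lam0 : 0 < lambda by rewrite (lt_trans _ lam4) // invr_gt0.
suff H n : P' [set w | Qinf w n = None] = 1%E by split.
exact: (limit_queue_infinite lam0 bp mQ Qcvg n lam4).
Qed.
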